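(* Let $n\ge2$, $m\ge2$, and let $M$ be a complete minimal $n$-dimensional submanifold in $\mathbb{R}^{m+n}$ with Gauss map $\gamma:M\to\mathbf{G}_{n,m}$. If the image $\gamma(M)$ is contained in an open geodesic ball in $\mathbf{G}_{n,m}$ of radius $\frac{\sqrt2}{4}\pi$, then $M$ has only one end.
   Context: Submanifolds are smooth, connected, oriented and isometrically immersed in Euclidean space; complete means complete in the induced metric; minimal means that the mean curvature vector (the trace of the second fundamental form) vanishes. $\mathbf{G}_{n,m}$ is the Grassmannian manifold of oriented $n$-dimensional linear subspaces of $\mathbb{R}^{m+n}$ with its canonical Riemannian metric $ds^2=\sum_{i,\alpha}\omega_{n+\alpha\, i}^2$, where $\{e_i,e_{n+\alpha}\}$ ($1\le i\le n$, $1\le\alpha\le m$) is an orthonormal frame of $\mathbb{R}^{m+n}$ with the $n$-plane spanned by $e_1,\dots,e_n$, and $\omega_{ab}$ are the Levi-Civita connection forms of the frame; equivalently, under $T_P\mathbf{G}_{n,m}=\mathrm{Hom}(P,P^\perp)$ the metric is the Hilbert-Schmidt inner product. The Gauss map is $\gamma(x)=T_xM\in\mathbf{G}_{n,m}$, via parallel translation. The open geodesic ball of radius $a$ centered at a point is the set of points at Riemannian distance less than $a$ from it. *)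

(* Defs.v *)
From HB Require Import structures.
From mathcomp Require Import all_boot all_order all_algebra.
From mathcomp Require Import all_classical all_reals all_analysis.

Set Implicit Arguments.
Unset Strict Implicit.
Unset Printing Implicit Defensive.

Import Order.TTheory GRing.Theory Num.Theory.
Import numFieldNormedType.Exports.

Local Open Scope classical_set_scope.
Local Open Scope ring_scope.

(* [U] is meant to be open. *)
Fixpoint Ck_on (R : realType) (V W : normedModType R) (k : nat)
    (U : set V) (f : V -> W) : Prop :=
  if k is k'.+1 then
    (forall x, U x -> differentiable f x) /\
    (forall v, Ck_on k' U (fun x => 'D_v f x))
  else forall x, U x -> {for x, continuous f}.

Definition smooth_on (R : realType) (V W : normedModType R)
    (U : set V) (f : V -> W) : Prop := forall k, Ck_on k U f.

(* The orientation is carried by the atlas: all changes of coordinates have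
   positive Jacobian determinant, and the positively oriented bases of the
   tangent spaces are the coordinate bases of the charts, up to GL+(n). *)
Record oriented_manifold (R : realType) (n : nat) := OrientedManifold {
  carrier :> topologicalType;
  carrier_hausdorff : hausdorff_space carrier;
  carrier_second_countable : @second_countable carrier;
  chart : Type;
  chart_dom : chart -> set 'rV[R]_n;
  chart_param : chart -> 'rV[R]_n -> carrier;
  chart_coord : chart -> carrier -> 'rV[R]_n;
  chart_dom_open : forall i, open (chart_dom i);
  chart_image_open : forall i, open (chart_param i @` chart_dom i);
  chart_paramK : forall i u, chart_dom i u ->
    chart_coord i (chart_param i u) = u;
  chart_param_continuous : forall i u, chart_dom i u ->
    {for u, continuous (chart_param i)};
  chart_coord_continuous : forall i x, (chart_param i @` chart_dom i) x ->
    {for x, continuous (chart_coord i)};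
  chart_cover : forall x, exists i, (chart_param i @` chart_dom i) x;
  transition_smooth : forall i j,
    smooth_on
      (chart_dom i `&` chart_param i @^-1` (chart_param j @` chart_dom j))
      (chart_coord j \o chart_param i);
  transition_orientation : forall i j u, chart_dom i u ->
    (chart_param j @` chart_dom j) (chart_param i u) ->
    0 < \det ('J (chart_coord j \o chart_param i) u)
}.

Definition chart_image (R : realType) (n : nat) (M : oriented_manifold R n)
  (i : chart M) : set M := chart_param i @` chart_dom i.

Section immersed_submanifold.
Variables (R : realType) (n N : nat) (M : oriented_manifold R n).
Variable F : M -> 'rV[R]_N.

Definition local_immersion (i : chart M) : 'rV[R]_n -> 'rV[R]_N :=
  F \o chart_param i.

(* The k-th row of ['J (local_immersion i) u] is the k-th coordinate tangent
   vector, so its rows form a basis of the tangent space. *)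
Definition is_immersion : Prop :=
  (forall i, smooth_on (chart_dom i) (local_immersion i)) /\
  (forall i u, chart_dom i u -> row_free ('J (local_immersion i) u)).

(* Hilbert-Schmidt norm; the norm [`|_|] of the library on matrices is the
   sup norm. *)
Definition hs_norm (p q : nat) (A : 'M[R]_(p, q)) : R :=
  Num.sqrt (\sum_i \sum_j A i j ^+ 2).

Definition C1_curve (c : R -> M) : Prop :=
  continuous c /\
  forall i : chart M, Ck_on 1 (c @^-1` chart_image i) (chart_coord i \o c).

(* For the induced metric, the length of c'(t) is the Euclidean length of
   (F \o c)'(t). *)
Definition curve_length (c : R -> M) : \bar R :=
  (\int[lebesgue_measure]_(t in `[0%R, 1%R]) (hs_norm (derive1 (F \o c) t))%:E)%E.

(* Curves need not be regular, so C^1 curves give the same infimum as piecewise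
   C^1 ones: reparametrize so as to stop at the corners. *)
Definition induced_dist (x y : M) : \bar R :=
  ereal_inf [set l | exists c : R -> M,
    [/\ C1_curve c, c 0 = x, c 1 = y & l = curve_length c]].

Definition is_complete : Prop :=
  forall s : nat -> M,
    (forall e : R, 0 < e -> exists k0, forall j k,
       (k0 <= j)%N -> (k0 <= k)%N -> (induced_dist (s j) (s k) < e%:E)%E) ->
    exists x : M, forall e : R, 0 < e -> exists k0, forall k,
      (k0 <= k)%N -> (induced_dist (s k) x < e%:E)%E.

Definition metric_mx (i : chart M) (u : 'rV[R]_n) : 'M[R]_n :=
  'J (local_immersion i) u *m ('J (local_immersion i) u)^T.

(* Matrix, acting on row vectors on the right, of the orthogonal projection
   onto the normal space. *)
Definition normal_proj (i : chart M) (u : 'rV[R]_n) : 'M[R]_N :=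
  1%:M - ('J (local_immersion i) u)^T *m invmx (metric_mx i u)
           *m 'J (local_immersion i) u.

(* B(d_k, d_l): normal part of the flat derivative of d_l along d_k. *)
Definition second_fundamental_form (i : chart M) (u : 'rV[R]_n)
    (k l : 'I_n) : 'rV[R]_N :=
  'D_(delta_mx 0 k) (fun v => 'D_(delta_mx 0 l) (local_immersion i) v) u
    *m normal_proj i u.

Definition mean_curvature (i : chart M) (u : 'rV[R]_n) : 'rV[R]_N :=
  \sum_k \sum_l
    (invmx (metric_mx i u)) k l *: second_fundamental_form i u k l.

Definition is_minimal : Prop :=
  forall i u, chart_dom i u -> mean_curvature i u = 0.

End immersed_submanifold.

(* An oriented n-plane is represented by the set of its positively oriented
   bases (the rows of the matrices), i.e. by an orbit of GL+(n). *)
Definition oriented_span (R : realType) (n N : nat) (A : 'M[R]_(n, N)) :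
    set 'M[R]_(n, N) :=
  [set B *m A | B in [set B : 'M[R]_n | 0 < \det B]].

Definition grassmannian (R : realType) (n N : nat) : set (set 'M[R]_(n, N)) :=
  [set oriented_span A | A in [set A : 'M[R]_(n, N) | row_free A]].
Arguments grassmannian : clear implicits.

(* A C^1 curve of orthonormal frames (e_1, ..., e_(n + m)), as rows; the curve
   of oriented n-planes is spanned by e_1, ..., e_n. Each C^1 curve in the
   Grassmannian is of this form. *)
Definition frame_curve (R : realType) (N : nat) (E : R -> 'M[R]_N) : Prop :=
  Ck_on 1 [set: R] E /\ forall t, E t *m (E t)^T = 1%:M.

(* omega_(a b)(d/dt) = <de_a/dt, e_b>, up to the sign convention. *)
Definition connection_form (R : realType) (N : nat) (E : R -> 'M[R]_N)
  (t : R) : 'M[R]_N := derive1 E t *m (E t)^T.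

Definition grassmann_length (R : realType) (n m : nat)
    (E : R -> 'M[R]_(n + m)) : \bar R :=
  (\int[lebesgue_measure]_(t in `[0%R, 1%R])
     (hs_norm (ursubmx (connection_form E t)))%:E)%E.

Definition grassmann_dist (R : realType) (n m : nat)
    (P Q : set 'M[R]_(n, n + m)) : \bar R :=
  ereal_inf [set l | exists E : R -> 'M[R]_(n + m),
    [/\ frame_curve E, P (usubmx (E 0)), Q (usubmx (E 1))
      & l = grassmann_length E]].

Definition geodesic_ball (R : realType) (n m : nat)
    (P : set 'M[R]_(n, n + m)) (a : R) : set (set 'M[R]_(n, n + m)) :=
  [set Q | grassmannian R n (n + m) Q /\ (grassmann_dist P Q < a%:E)%E].

(* The set of positively oriented bases of T_x M; no chart is chosen, see
   [gauss_map_chart]. *)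
Definition gauss_map (R : realType) (n N : nat) (M : oriented_manifold R n)
    (F : M -> 'rV[R]_N) (x : M) : set 'M[R]_(n, N) :=
  [set A | exists2 i : chart M, chart_image i x &
     oriented_span ('J (local_immersion F i) (chart_coord i x)) A].

Lemma jacobian_transition (R : realType) (n N : nat) (M : oriented_manifold R n)
    (F : M -> 'rV[R]_N) (i j : chart M) (x : M) :
  is_immersion F -> chart_image i x -> chart_image j x ->
  'J (local_immersion F j) (chart_coord j x) =
    'J (chart_coord i \o chart_param j) (chart_coord j x) *m 'J (local_immersion F i) (chart_coord i x).
Proof.
move=> [Fsm _] ix [u ju ux].
have jx : chart_coord j x = u by rewrite -ux chart_paramK.
have tsm := @transition_smooth R n M j i.
have Tu : (chart_dom j `&` chart_param j @^-1` (chart_param i @` chart_dom i)) u.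
  by split=> //=; rewrite ux.
have dT : differentiable (chart_coord i \o chart_param j) u := (tsm 1%N).1 u Tu.
have iu : chart_dom i (chart_coord i x) by case: ix => v iv <-; rewrite chart_paramK.
have dFi : differentiable (local_immersion F i) (chart_coord i x) :=
  (Fsm i 1%N).1 _ iu.
have dFj : differentiable (local_immersion F j) u := (Fsm j 1%N).1 _ ju.
have cE : (chart_coord i \o chart_param j) u = chart_coord i x by rewrite /= ux.
rewrite jx; apply/row_matrixP => k; rewrite !rowE mulmxA.
set v := delta_mx 0 k.
rewrite -deriveEjacobian // -[v *m _]deriveEjacobian // -[RHS]deriveEjacobian //.
rewrite (@near_eq_derive _ _ _ _
  (local_immersion F i \o (chart_coord i \o chart_param j))); last first.
  have cj : {for u, continuous (@chart_param R n M j)} :=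
    chart_param_continuous ju.
  have : nbhs u (@chart_param R n M j @^-1`
                   (@chart_param R n M i @` chart_dom i)).
    apply: cj; apply: open_nbhs_nbhs.
    by split; [exact: chart_image_open|rewrite ux].
  by apply: filterS => w [w' iw' ww']; rewrite /local_immersion /= -ww' chart_paramK.
rewrite -cE in dFi *.
rewrite deriveE; last exact: differentiable_comp.
by rewrite diff_comp //= -!deriveE.
Qed.

Lemma gauss_map_chart (R : realType) (n N : nat) (M : oriented_manifold R n)
    (F : M -> 'rV[R]_N) (i : chart M) (x : M) :
  is_immersion F -> chart_image i x ->
  gauss_map F x = oriented_span ('J (local_immersion F i) (chart_coord i x)).
Proof.
move=> imF ix; apply/seteqP; split=> [A [j jx [B B0 <-]]|A iA]; last by exists i.
rewrite (jacobian_transition imF ix jx) mulmxA.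
exists (B *m 'J (chart_coord i \o chart_param j) (chart_coord j x)) => //=.
rewrite det_mulmx mulr_gt0 //.
case: jx => u ju ux; rewrite -ux chart_paramK //.
by apply: transition_orientation => //; rewrite ux.
Qed.

Lemma gauss_map_grassmannian (R : realType) (n N : nat)
    (M : oriented_manifold R n) (F : M -> 'rV[R]_N) (x : M) :
  is_immersion F -> grassmannian R n N (gauss_map F x).
Proof.
move=> imF; have [i ix] := chart_cover x.
exists ('J (local_immersion F i) (chart_coord i x)); last first.
  by rewrite (gauss_map_chart imF ix).
by apply: imF.2; case: ix => u iu <-; rewrite chart_paramK.
Qed.

(* Ends in the sense of Freudenthal: compatible choices, for each compact K, of
   a connected component of the complement of K. *)
Definition is_end (T : topologicalType)
    (e : {K : set T | compact K} -> set T) : Prop :=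
  (forall K, exists2 x, (~` sval K) x &
     e K = connected_component (~` sval K) x) /\
  (forall K L, sval K `<=` sval L -> e L `<=` e K).

Definition has_one_end (T : topologicalType) : Prop :=
  exists! e : {K : set T | compact K} -> set T, is_end e.

(* Main.v *)
(* Since sqrt 2 / 4 * pi < pi / 2, the tangent planes of M make angles bounded
   away from pi / 2 with the centre P0 of the ball: along a frame curve from P0
   to T_x M, the angle between a fixed vector v of T_x M and the moving plane
   changes at most at the speed of the curve. Hence the orthogonal projection of
   M to P0 = R^n is a local diffeomorphism that contracts lengths by at most a
   bounded factor. As M is complete, segments of R^n then lift to M, and since
   R^n is simply connected the projection is a homeomorphism. Finally R^n has one
   end for n >= 2. *)
From HB Require Import structures.
Require Import Defs.
From mathcomp Require Import all_boot all_order all_algebra.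
From mathcomp Require Import all_classical all_reals all_analysis.
From mathcomp Require Import ring lra.
Import Order.TTheory GRing.Theory Num.Theory.
Import numFieldNormedType.Exports.
Local Open Scope classical_set_scope.
Local Open Scope ring_scope.
Set Implicit Arguments.
Unset Strict Implicit.
Unset Printing Implicit Defensive.

(** * Ends of R^n *)

(** Simple connectedness of R^n enters through convexity: two sections over convex sets that agree
    at one common point agree on the whole overlap, so local sections glue along the segments
    issuing from the image of a base point. This gives a continuous section [S] of the projection;
    since [M] is connected, [S] is also a left inverse. Completeness speaks of Cauchy sequences for
    the induced distance, while lifting needs limits in the topology of [M]. Two estimates bridge
    the gap: the projection does not increase lengths, so points at small distance lie in one sheet
    over a small ball; and it shrinks lengths at most by the factor [c], so a lifted ray is
    Lipschitz for the induced distance. Angles are measured through the squared cosine [g], where 2g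
    - 1 is the cosine of the double angle. Curves have the whole of [R] as domain, so paths along a
    segment are reparametrized by a map into [0, 1]. *)

Lemma segment_connected_component (R : realType) (V : normedModType R)
    (A : set V) (a b : V) :
  (forall t : R, 0 <= t <= 1 -> A (a + t *: (b - a))) ->
  connected_component A a b.
Proof.
move=> seg; pose f (t : R) : V := a + t *: (b - a).
have cf : continuous f.
  by move=> t; apply: cvgD; [exact: cvg_cst|apply: cvgZr_tmp; exact: cvg_id].
have fI : f @` `[0, 1] `<=` A.
  by move=> _ [t + <-]; rewrite /= in_itv /=; exact: seg.
apply: (connected_component_max _ fI).
- by exists 0; rewrite /f ?scale0r ?addr0 //= in_itv /=; lra.
- apply: connected_continuous_connected; first exact: segment_connected.
  exact: continuous_subspaceT.
- by exists 1; rewrite /f ?scale1r ?subrKC //= in_itv /=; lra.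
Qed.

Lemma rV_coord_le_norm (R : realType) n (v : 'rV[R]_n) j : `|v 0 j| <= `|v|.
Proof.
by rewrite [leRHS]/Num.norm /= mx_normrE; apply/bigmax_geP; right;
  exists (0, j).
Qed.

Lemma rV_norm_coord (R : realType) n (v : 'rV[R]_n) (r : R) :
  0 <= r -> r < `|v| -> exists j, r < `|v 0 j|.
Proof.
move=> r0; rewrite [ltRHS]/Num.norm /= mx_normrE => /bigmax_gtP[|[[i j] _ /=]].
  by rewrite ltNge r0.
by rewrite ord1 => ?; exists j.
Qed.

(** The norm is the sup norm, so the outside of the ball is the union of the half-spaces
    [r < s * w 0 j] with s = 1 or s = -1. Each is convex, and two of them in different coordinates
    meet; opposite ones in the same coordinate are joined through a second coordinate, which exists
    because n is at least 2. *)
Lemma connected_component_outside_ball (R : realType) n (r : R)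
    (y z : 'rV[R]_n) : (2 <= n)%N -> 0 <= r -> r < `|y| -> r < `|z| ->
  connected_component [set w : 'rV[R]_n | r < `|w|] y z.
Proof.
move=> n2 r0.
have half (s : R) j (a b : 'rV[R]_n) : `|s| = 1 -> r < s * a 0 j ->
    r < s * b 0 j -> connected_component [set w : 'rV[R]_n | r < `|w|] a b.
  move=> s1 ra rb; apply: segment_connected_component => t t01 /=.
  apply: lt_le_trans (rV_coord_le_norm _ j).
  rewrite -[ltRHS]mul1r -s1 -normrM; apply: lt_le_trans (ler_norm _).
  rewrite !mxE; case/andP: t01; rewrite le_eqVlt => /orP[/eqP<-|t0 t1].
    by rewrite mul0r addr0.
  by nra.
have corner (s s' : R) j k (a b : 'rV[R]_n) : j != k -> `|s| = 1 -> `|s'| = 1 ->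
    r < s * a 0 j -> r < s' * b 0 k ->
    connected_component [set w : 'rV[R]_n | r < `|w|] a b.
  move=> jk s1 s1' ra rb.
  pose w : 'rV[R]_n :=
    (s * (r + 1)) *: delta_mx 0 j + (s' * (r + 1)) *: delta_mx 0 k.
  have sq (x : R) : `|x| = 1 -> x * (x * (r + 1)) = r + 1.
    by move=> x1;
      rewrite mulrA -expr2 -(real_normK (num_real x)) x1 expr1n mul1r.
  have wj : s * w 0 j = r + 1.
    by rewrite !mxE !eqxx (negbTE jk) /= mulr1 mulr0 addr0 sq.
  have wk : s' * w 0 k = r + 1.
    by rewrite !mxE !eqxx eq_sym (negbTE jk) /= mulr1 mulr0 add0r sq.
  apply: (@connected_component_trans _ _ w).
    by apply: (half s j) => //; rewrite wj ltrDl.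
  by apply: (half s' k) => //; rewrite wk ltrDl.
move=> /(rV_norm_coord r0)[j rj] /(rV_norm_coord r0)[k rk].
have sgP (x : R) : r < `|x| -> `|Num.sg x| = 1 /\ r < Num.sg x * x.
  move=> rx; rewrite -normrEsg; split=> //.
  by rewrite normr_sg -normr_gt0 (le_lt_trans r0 rx).
have [sj rj'] := sgP _ rj; have [sk rk'] := sgP _ rk.
have [jk|jk] := eqVneq j k; last exact: corner jk sj sk rj' rk'.
have [l lj] : exists l, l != j.
  have i0 : (0 < n)%N by apply: leq_trans n2.
  have [->|j0] := eqVneq j (Ordinal i0); last by exists (Ordinal i0);
    rewrite eq_sym.
  by exists (Ordinal n2).
pose w : 'rV[R]_n := (r + 1) *: delta_mx 0 l.
have wl : r < 1 * w 0 l by rewrite !mxE !eqxx mulr1 mul1r ltrDl.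
apply: (@connected_component_trans _ _ w).
  by apply: corner sj (normr1 _) rj' wl; rewrite eq_sym.
by rewrite -jk in rk' sk; apply: corner lj (normr1 _) sk wl rk'.
Qed.

Lemma connected_componentS (T : topologicalType) (A B : set T) (x : T) :
  A `<=` B -> connected_component A x `<=` connected_component B x.
Proof.
by move=> AB y [C [Cx CA cC] Cy]; exists C => //; split=> //;
  exact: subset_trans AB.
Qed.

Lemma connected_component_image (T U : topologicalType) (f : T -> U)
    (A : set T) (B : set U) (x y : T) :
  continuous f -> f @` A `<=` B -> connected_component A x y ->
  connected_component B (f x) (f y).
Proof.
move=> cf AB [C [Cx CA cC] Cy]; exists (f @` C); last by exists y.
split; first by exists x.
  by apply: subset_trans AB; exact: image_subset.
by apply: connected_continuous_connected => //; exact: continuous_subspaceT.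
Qed.

(** The end consists of the components that contain the image under [S] of the outside of a large
    ball. An arbitrary end agrees with it because every compact [K] lies in the image of a closed
    ball. *)
Lemma homeo_rV_has_one_end (R : realType) n (T : topologicalType)
    (S : 'rV[R]_n -> T) (G : T -> 'rV[R]_n) :
  (2 <= n)%N -> continuous S -> continuous G -> cancel S G -> cancel G S ->
  has_one_end T.
Proof.
move=> n2 cS cG SK GK.
pose far (K : set T) (r : R) := 0 <= r /\ forall z, K z -> `|G z| <= r.
have farE K : compact K -> exists r, far K r.
  move=> cK.
  have : compact (G @` K).
    by apply: continuous_compact => //; exact: continuous_subspaceT.
  move=> /compact_bounded[r [_ rP]].
  exists (`|r| + 1); split; first by rewrite addr_ge0.
  move=> z Kz; apply: rP; last by exists z.
  by rewrite (le_lt_trans (ler_norm r)) // ltrDl.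
(* The union over all admissible radii avoids choosing one for each [K]; [e0E] shows that they all
   give the same component. *)
pose e0 (K : {K : set T | compact K}) := [set z | exists r, far (sval K) r /\
  exists2 y, r < `|y| & connected_component (~` sval K) (S y) z].
have out (K : set T) r y : far K r -> r < `|y| -> (~` K) (S y).
  by move=> [_ rK] ry /rK; rewrite SK leNgt ry.
have link K r r' y y' : far K r -> far K r' -> r < `|y| -> r' < `|y'| ->
    connected_component (~` K) (S y) (S y').
  wlog rr : r r' y y' / r <= r'.
    move=> W fr fr' ry ry'; have [rr|/ltW rr] := leP r r'.
      exact: (W r r').
    by apply: connected_component_sym; exact: (W r' r).
  move=> fr fr' ry ry'.
  apply: (connected_component_image cS
            (A := [set w : 'rV[R]_n | r < `|w|])).
    by move=> _ [w /= rw <-]; exact: out rw.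
  apply: connected_component_outside_ball => //; first exact: fr.1.
  exact: le_lt_trans ry'.
have bigv r : exists y : 'rV[R]_n, r < `|y|.
  pose i := Ordinal (leq_trans (isT : (0 < 2)%N) n2).
  exists ((`|r| + 1) *: delta_mx 0 i).
  apply: lt_le_trans (rV_coord_le_norm _ i).
  rewrite !mxE !eqxx mulr1; apply: lt_le_trans (ler_norm _).
  by rewrite (le_lt_trans (ler_norm r)) // ltrDl.
have e0E K r y : far (sval K) r -> r < `|y| ->
    e0 K = connected_component (~` sval K) (S y).
  move=> fr ry; apply/seteqP; split=> [z [r' [fr' [y' ry']]]|z Cz].
    by apply: connected_component_trans; exact: (link (sval K) r r').
  by exists r; split=> //; exists y.
exists e0; split.
  split=> [K|K L KL z [r [[r0 fr] [y ry Cz]]]].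
    have [r fr] := farE _ (svalP K); have [y ry] := bigv r.
    by exists (S y); [exact: out ry|exact: e0E ry].
  exists r; split; first by split=> // w Kw; apply: fr; exact: KL.
  exists y => //; apply: connected_componentS Cz.
  by move=> w Lw Kw; apply: Lw; exact: KL.
(* The image [L] of the closed ball of radius [r] contains [K], so [e L] lies in [e K]. A point [x]
   of [e L] outside [L] has [r < |G x|], which determines the component. *)
move=> e [eK emono]; apply/funext => K.
have [r fr] := farE _ (svalP K).
have cL : compact (S @` [set y : 'rV[R]_n | `|y| <= r]).
  apply: continuous_compact; first exact: continuous_subspaceT.
  apply: bounded_closed_compact.
    exists r; split; first exact: num_real.
    by move=> x rx y /= yr; exact: le_trans (ltW rx).
  have -> : [set y : 'rV[R]_n | `|y| <= r] = closed_ball_ Num.norm 0 r.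
    by apply/seteqP; split=> y; rewrite /closed_ball_ /= sub0r normrN.
  exact: closed_closed_ball_.
pose L : {K : set T | compact K} := exist _ _ cL.
have KL : sval K `<=` sval L.
  by move=> z Kz; exists (G z); [exact: fr.2|exact: GK].
have [x Lx eL] := eK L; have [x' Kx' eKE] := eK K.
have rx : r < `|G x|.
  by rewrite ltNge; apply/negP => rx; apply: Lx; exists (G x) => //; exact: GK.
have xK : connected_component (~` sval K) x' x.
  by rewrite -eKE; apply: (emono K L KL); rewrite eL;
    exact: connected_component_refl.
rewrite eKE (e0E K r (G x)) // GK.
by apply: same_connected_component; exact: connected_component_sym.
Qed.

(** * Lifting through local homeomorphisms *)

Lemma near_eq_continuous (T U : topologicalType) (f g : T -> U) (x : T) :
  (\forall z \near x, f z = g z) -> {for x, continuous f} ->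
  {for x, continuous g}.
Proof.
move=> fg cf A; rewrite -(nbhs_singleton fg) => /cf.
by apply: filterS2 fg => z fgz /=; rewrite fgz.
Qed.

(* A smooth map of R into [0, 1] with 0 |-> 0 and 1 |-> 1: reparametrizing by
   it, a map defined on [0, 1] becomes defined on the whole of R. *)
Definition ramp (R : realType) (t : R) : R := sin (t * (pi / 2)) ^+ 2.

Lemma ramp0 (R : realType) : ramp (0 : R) = 0.
Proof. by rewrite /ramp mul0r sin0 expr0n. Qed.

Lemma ramp1 (R : realType) : ramp (1 : R) = 1.
Proof. by rewrite /ramp mul1r sin_pihalf expr1n. Qed.

Lemma ramp_itv (R : realType) (t : R) : 0 <= ramp t <= 1.
Proof.
rewrite /ramp sqr_ge0 /=; have := cos2Dsin2 (t * (pi / 2)).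
by have := sqr_ge0 (cos (t * (pi / 2))); lra.
Qed.

Lemma is_derive_ramp (R : realType) (t : R) :
  is_derive t 1 (@ramp R)
    (2 * sin (t * (pi / 2)) * (cos (t * (pi / 2)) * (pi / 2))).
Proof.
have -> : @ramp R = (@sin R \o ((pi / 2) \*: id)) ^+ 2.
  by apply/funext => x; rewrite /ramp fctE /= mulrC.
have d1 : is_derive t 1 ((pi / 2) \*: @id R) (pi / 2).
  by apply: is_derive_eq; rewrite /GRing.scale /= mulr1.
have d2 : is_derive t 1 (@sin R \o ((pi / 2) \*: id))
    (cos (t * (pi / 2)) * (pi / 2)).
  have -> : t * (pi / 2) = ((pi / 2) \*: @id R) t by rewrite /= mulrC.
  exact: is_derive1_comp.
apply: is_derive_eq.
by rewrite /= /GRing.scale /= expr1 (mulrC _ t); ring.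
Qed.

Lemma continuous_ramp (R : realType) : continuous (@ramp R).
Proof.
move=> t; apply: differentiable_continuous; apply/derivable1_diffP.
exact: (@ex_derive _ _ _ _ _ _ _ (is_derive_ramp t)).
Qed.

Section lifting.
Variables (R : realType) (V : normedModType R) (T : topologicalType).
Hypothesis hT : hausdorff_space T.
Variable G : T -> V.
Hypothesis cG : continuous G.
Hypothesis G_loc_inj : forall x : T, exists2 W : set T, nbhs x W &
  forall a b, W a -> W b -> G a = G b -> a = b.

(** The set where the lifts agree is open because [G] is locally injective, and closed because [T]
    is Hausdorff. *)
Lemma unique_lift (X : topologicalType) (f g : X -> T) (x0 : X) :
  connected [set: X] -> continuous f -> continuous g ->
  (forall x, G (f x) = G (g x)) -> f x0 = g x0 -> f = g.
Proof.
move=> cX cf cg fg fg0; apply/funext => x.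
suff fgT : [set x | f x = g x] = setT by have : [set: X] x by []; rewrite -fgT.
apply: cX; first by exists x0.
- exists [set x | f x = g x]; last by rewrite setTI.
  rewrite openE => y /= fgy; have [W Wy WI] := G_loc_inj (f y).
  have fW : \forall z \near y, W (f z) by exact: cf.
  have gW : \forall z \near y, W (g z) by apply: cg; rewrite -fgy.
  by near=> z; apply: WI => //; near: z.
- exists [set x | f x = g x]; last by rewrite setTI.
  move=> y clfg; apply: hT => A B /cf fA /cg gB.
  have yAB : nbhs y (f @^-1` A `&` g @^-1` B) by exact: filterI.
  have [z [fgz [Az Bz]]] := clfg _ yAB.
  by exists (f z); split=> //; rewrite fgz.
Unshelve. all: by end_near. Qed.

Definition convex_subset (D : set V) := forall a b (t : R), D a -> D b ->
  0 <= t <= 1 -> D (a + t *: (b - a)).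

Lemma continuous_ramp_segment (a b : V) :
  continuous (fun t : R => a + ramp t *: (b - a)).
Proof.
move=> t; apply: cvgD; first exact: cvg_cst.
by apply: cvgZr_tmp; exact: continuous_ramp.
Qed.

Definition section_on (D : set V) (s : V -> T) :=
  forall y, D y -> {for y, continuous s} /\ G (s y) = y.

(** Both sections are pulled back to the segment from [a] to [b]. The ramp keeps the path in [D] for
    every real parameter, so that [unique_lift] applies to the connected space [R]. *)
Lemma unique_section (D : set V) (s s' : V -> T) (a b : V) :
  convex_subset D -> section_on D s -> section_on D s' -> D a -> D b ->
  s a = s' a -> s b = s' b.
Proof.
move=> cD Ds Ds' Da Db sa.
pose p (t : R) := a + ramp t *: (b - a).
have Dp t : D (p t) by apply: cD => //; exact: ramp_itv.
have cp : continuous p by exact: continuous_ramp_segment.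
have p0 : p 0 = a by rewrite /p ramp0 scale0r addr0.
have p1 : p 1 = b by rewrite /p ramp1 scale1r subrKC.
have /(congr1 (fun f => f 1)) : s \o p = s' \o p; last by rewrite /= p1.
apply: (@unique_lift _ _ _ 0).
- by apply/connected_intervalP => ? ? _ _ ? _.
- by move=> t; apply: continuous_comp; [exact: cp|exact: (Ds _ _).1].
- by move=> t; apply: continuous_comp; [exact: cp|exact: (Ds' _ _).1].
- by move=> t /=; rewrite (Ds _ _).2 // (Ds' _ _).2.
- by rewrite /= p0.
Qed.

Definition tube (a b : V) (r : R) := [set z : V | exists2 l : R, 0 <= l <= 1 &
  `|z - (a + l *: (b - a))| < r].

Lemma tube_open a b r : open (tube a b r).
Proof.
have -> : tube a b r =
    \bigcup_(l in [set l : R | 0 <= l <= 1]) ball (a + l *: (b - a)) r.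
  apply/seteqP; split=> z [l l01 zl]; exists l => //.
    by rewrite -ball_normE /= distrC.
  by move: zl; rewrite -ball_normE /= distrC.
by apply: bigcup_open => l _; exact: ball_open.
Qed.

Lemma norm_combination_lt (u v : V) (t r : R) : `|u| < r -> `|v| < r ->
  0 <= t <= 1 -> `|(1 - t) *: u + t *: v| < r.
Proof.
move=> ur vr /andP[t0 t1]; apply: le_lt_trans (ler_normD _ _) _.
rewrite !normrZ ger0_norm ?subr_ge0 // (ger0_norm t0).
by move: t0; rewrite le_eqVlt => /orP[/eqP<-|t0]; nra.
Qed.

Lemma combinationE (u v : V) (t : R) : u + t *: (v - u) = (1 - t) *: u + t *: v.
Proof. by rewrite scalerBr scalerBl scale1r addrA addrAC. Qed.

Lemma tube_convex a b r : convex_subset (tube a b r).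
Proof.
move=> u v t [l l01 ul] [k k01 vk] t01.
exists ((1 - t) * l + t * k); first by nra.
rewrite combinationE.
have -> : (1 - t) *: u + t *: v - (a + ((1 - t) * l + t * k) *: (b - a)) =
    (1 - t) *: (u - (a + l *: (b - a))) + t *: (v - (a + k *: (b - a))).
  move: (b - a) => w; rewrite !scalerBr addrACA -opprD; congr (_ - _).
  by rewrite !scalerDr addrACA -scalerDl subrK scale1r !scalerA -scalerDl.
exact: norm_combination_lt.
Qed.

Lemma ball_convex (a : V) r : convex_subset (ball a r).
Proof.
move=> u v t; rewrite -ball_normE /= => au av t01; rewrite combinationE.
have -> : a - ((1 - t) *: u + t *: v) = (1 - t) *: (a - u) + t *: (a - v).
  by rewrite !scalerBr addrACA -scalerDl subrK scale1r opprD.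
exact: norm_combination_lt.
Qed.

(** A point of the tube lies on a translate of the segment by a vector of norm less than [r], and
    the ends of this translate lie in the two balls. *)
Lemma tube_sub (C : set V) a b r : convex_subset C ->
  ball a r `<=` C -> ball b r `<=` C -> tube a b r `<=` C.
Proof.
move=> cC aC bC z [l l01 zl]; pose e := z - (a + l *: (b - a)).
have -> : z = (a + e) + l *: ((b + e) - (a + e)).
  by rewrite opprD addrACA subrr addr0 addrAC /e subrKC.
apply: cC => //.
  by apply: aC; rewrite -ball_normE /= opprD addNKr normrN.
by apply: bC; rewrite -ball_normE /= opprD addNKr normrN.
Qed.

Hypothesis T_connected : connected [set: T].
Hypothesis G_loc_section : forall x : T, exists2 r : R, 0 < r &
  exists2 s : V -> T,
  s (G x) = x & section_on (ball (G x) r) s.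

(** [s (G z)] and [z] have the same image under [G] and both are close to [x], where [G] is
    injective; so a local section is also a left inverse near [x]. *)
Lemma near_local_section x r (s : V -> T) : 0 < r -> s (G x) = x ->
  section_on (ball (G x) r) s ->
  \forall z \near x, ball (G x) r (G z) /\ s (G z) = z.
Proof.
move=> r0 sx Gs; have [W Wx WI] := G_loc_inj x.
have xG : ball (G x) r (G x) by exact: ballxx.
have GB : \forall z \near x, ball (G x) r (G z).
  by apply: cG; exact: nbhsx_ballx.
have sW : \forall z \near x, W (s (G z)).
  have := @continuous_comp _ _ _ G s x (@cG x) (Gs _ xG).1; apply.
  by rewrite /= sx.
near=> z; have Bz : ball (G x) r (G z) by near: z.
split=> //; apply: WI; [by near: z|by near: z|exact: (Gs _ Bz).2].
Unshelve. all: by end_near. Qed.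

Variable x0 : T.
(* Rays lifted from [x0] do not run to infinity in finite time. *)
Hypothesis ray_lift : forall (v : V) (tau d : R) (f : R -> T),
  0 < tau -> 0 < d -> f 0 = x0 ->
  (forall t : R, - d < t < tau -> {for t, continuous f}) ->
  (forall t : R, - d < t < tau -> G (f t) = G x0 + t *: v) ->
  exists x, cluster (f @ tau^'-) x.

(** * Gluing sections along rays *)

Let y0 := G x0.

(** Convexity makes uniqueness work: the overlap of two such domains is again convex and contains
    [y0], where both sections take the value [x0]. *)
Let good (D : set V) (s : V -> T) :=
  [/\ open D, convex_subset D, D y0, s y0 = x0 & section_on D s].

Let good_unique D s D' s' y : good D s -> good D' s' -> D y -> D' y ->
  s y = s' y.
Proof.
move=> [_ cD D0 s0 Ds] [_ cD' D0' s0' Ds'] Dy Dy'.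
apply: (@unique_section (D `&` D') _ _ y0) => //.
- by move=> a b t [Da Da'] [Db Db'] t01; split; [exact: cD|exact: cD'].
- by move=> z [? _]; exact: Ds.
- by move=> z [_ ?]; exact: Ds'.
- by rewrite s0.
Qed.

Let covered y := exists D s, good D s /\ D y.

(** By [good_unique] the value does not depend on the pair behind it; [x0] is only the default
    outside the covered set. *)
Let S y := xget x0 [set z | exists D s, [/\ good D s, D y & z = s y]].

Let SE D s y : good D s -> D y -> S y = s y.
Proof.
move=> Ds Dy; rewrite /S;
  case: xgetP => [z _ [D' [s' [Ds' Dy' ->]]]|/(_ (s y))].
  exact: (@good_unique D' s' D s).
by case; exists D, s.
Qed.

Let covered_star v (t t' : R) : 0 <= t -> t <= t' -> covered (y0 + t' *: v) ->
  covered (y0 + t *: v).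
Proof.
move=> t0 tt' [D [s [[oD cD D0 s0 Ds] Dt']]]; exists D, s; split=> //.
have [t'0|t'0] := eqVneq t' 0.
  have -> : t = 0 by lra.
  by rewrite scale0r addr0.
have -> : y0 + t *: v = y0 + (t / t') *: (y0 + t' *: v - y0).
  by rewrite addrAC subrr add0r scalerA divfK.
have t'p : 0 < t' by rewrite lt_neqAle eq_sym t'0 (le_trans t0).
by apply: cD => //; rewrite divr_ge0 ?(ltW t'p) //= ler_pdivrMr // mul1r.
Qed.

Let covered_open y : covered y -> \forall z \near y, covered z.
Proof.
move=> [D [s [Ds Dy]]]; have [oD _ _ _ _] := Ds.
have : nbhs y D by exact: open_nbhs_nbhs.
by apply: filterS => z Dz; exists D, s.
Qed.

Let covered_section y : covered y -> {for y, continuous S} /\ G (S y) = y.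
Proof.
move=> [D [s [Ds Dy]]]; have [oD _ _ _ sD] := Ds; split.
  apply: near_eq_continuous (sD _ Dy).1.
  have : nbhs y D by exact: open_nbhs_nbhs.
  by apply: filterS => z Dz; rewrite (SE Ds).
by rewrite (SE Ds Dy) (sD _ Dy).2.
Qed.

Let covered_center : covered y0.
Proof.
have [r r0 [s sx Gs]] := G_loc_section x0.
exists (ball y0 r), s; split; last exact: ballxx.
split=> //; [exact: ball_open|exact: ball_convex|exact: ballxx].
Qed.

Let continuous_line (v : V) : continuous (fun t : R => y0 + t *: v).
Proof.
by move=> t; apply: cvgD; [exact: cvg_cst|apply: cvgZr_tmp; exact: cvg_id].
Qed.

(** The lifted ray clusters at a point [x] above its end point. A section around [x] takes over from
    a section [s1] around the earlier part of the segment, and the two are glued on a thin tube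
    around the whole segment. *)
Let covered_extension v (tau : R) : 0 < tau ->
  (forall t : R, 0 <= t < tau -> covered (y0 + t *: v)) ->
  \forall t \near tau, covered (y0 + t *: v).
Proof.
move=> tau0 cov.
(* Some times before 0 are covered as well, which makes the lifted ray continuous at 0 from both
   sides. *)
have [d /= d0 dP] : \forall t \near (0 : R), covered (y0 + t *: v).
  apply: (@continuous_line v 0); rewrite /= scale0r addr0.
  exact: covered_open covered_center.
pose f (t : R) := S (y0 + t *: v).
have cov' (t : R) : - d < t < tau -> covered (y0 + t *: v).
  move=> /andP[td tt]; have [t0|t0] := leP 0 t; first by apply: cov; rewrite t0.
  by apply: dP; rewrite /= sub0r normrN ltr0_norm // ltrNl.
have [x xf] : exists x, cluster (f @ tau^'-) x.
  apply: (@ray_lift v tau d) => //.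
  - rewrite /f scale0r addr0.
    by have [D [s [Ds Ds0]]] := covered_center; rewrite (SE Ds Ds0); case: Ds.
  - move=> t /cov' ct.
    exact: (@continuous_comp _ _ _ (fun t : R => y0 + t *: v) S t
      (@continuous_line v t) (covered_section ct).1).
  - by move=> t /cov' /covered_section[].
have [r r0 [s sx Gs]] := G_loc_section x.
have near_x := near_local_section r0 sx Gs.
(* A cluster point need only be approached at some times, so [G x] is compared with the end point
   through one time at which the ray is within [e / 2] of both. *)
have Gx : G x = y0 + tau *: v.
  apply/eqP; rewrite -subr_eq0 -normr_le0; apply/ler_addgt0Pl => e e0.
  rewrite addr0.
  have e2 : 0 < e / 2 by rewrite divr_gt0.
  have A1 : (f @ tau^'-) (f @` [set t | 0 < t < tau /\
      ball (y0 + tau *: v) (e / 2) (y0 + t *: v)]).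
    rewrite /= /nbhs /=; near=> t; exists t => //=; split.
      by apply/andP; split; near: t; [exact: nbhs_left_gt|exact: nbhs_left_lt].
    near: t; apply: cvg_at_left_filter (@continuous_line v tau) _ _.
    exact: nbhsx_ballx.
  have A2 : \forall z \near x, ball (G x) (e / 2) (G z).
    by apply: cG; exact: nbhsx_ballx.
  have [_ [[t [/andP[t0 tt] Bt] <-] Bx]] := xf _ _ A1 A2.
  move: Bx; rewrite (covered_section (cov' _ _)).2; last by lra.
  by move=> Bx; apply: ltW; have := ball_splitl Bx Bt; rewrite -ball_normE.
(* At [t1] the lifted ray is close enough to [x] to lie on the sheet of [s], so [s] and the earlier
   sections agree at one point. *)
have [t1 [t1tau [t10 [Bt1 st1]]]] : exists t1 : R, t1 < tau /\
    (0 < t1 /\ (ball (G x) r (y0 + t1 *: v) /\ s (y0 + t1 *: v) = f t1)).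
  have A1 : (f @ tau^'-) (f @` [set t | 0 < t < tau]).
    rewrite /= /nbhs /=; near=> t; exists t => //=.
    by apply/andP; split; near: t; [exact: nbhs_left_gt|exact: nbhs_left_lt].
  have [_ [[t1 /andP[t10 t1tau] <-] [Bt1 st1]]] := xf _ _ A1 near_x.
  have Gt1 : G (f t1) = y0 + t1 *: v.
    by apply: (covered_section (cov' _ _)).2; lra.
  by exists t1; rewrite -Gt1.
have [D1 [s1 [Ds1 D1t]]] : covered (y0 + t1 *: v) by apply: cov'; lra.
have [oD cD D0 s0 sD] := Ds1.
pose B := ball (G x) r.
have DB y : D1 y -> B y -> s1 y = s y.
  move=> Dy By; apply: (@unique_section (D1 `&` B) _ _ (y0 + t1 *: v)) => //.
  - move=> a b t [Da Ba] [Db Bb] t01.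
    by split; [exact: cD|exact: ball_convex].
  - by move=> z [? _]; exact: sD.
  - by move=> z [_ ?]; exact: Gs.
  - by rewrite st1 /f (SE Ds1).
have ballP (C : set V) (y : V) : open C -> C y ->
    exists2 e, 0 < e & ball y e `<=` C.
  move=> oC Cy; have : nbhs y C by exact: open_nbhs_nbhs.
  by move=> /nbhs_ballP[e e0 eC]; exists e.
have oB : open B by exact: ball_open.
have [e1 e10 e1P] := ballP D1 y0 oD D0.
have [e2 e20 e2P] := ballP D1 _ oD D1t.
have [e3 e30 e3P] := ballP B _ oB Bt1.
have [e4 e40 e4P] : exists2 e, 0 < e & ball (y0 + tau *: v) e `<=` B.
  by apply: ballP => //; rewrite -Gx; exact: ballxx.
(* With this radius, the balls at both ends of the part before [t1] fit in [D1], and those at both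
   ends of the part after [t1] fit in [B]. *)
pose e := Num.min (Num.min e1 e2) (Num.min e3 e4).
have e0 : 0 < e by rewrite !lt_min e10 e20 e30 e40.
have [le1 [le2 [le3 le4]]] : e <= e1 /\ e <= e2 /\ e <= e3 /\ e <= e4.
  by rewrite !ge_min !lexx !orbT.
pose D := tube y0 (y0 + tau *: v) e.
have line0 (a : R) : y0 + a *: v - y0 = a *: v by rewrite addrAC subrr add0r.
(* The tube is cut at time [t1]; each of the two pieces is contained in a convex set by
   [tube_sub]. *)
have DDB z : D z -> D1 z \/ B z.
  move=> [l /andP[l0 l1] zl]; rewrite line0 scalerA in zl.
  have [lt1|lt1] := leP (l * tau) t1.
    left; apply: (@tube_sub D1 y0 (y0 + t1 *: v) e) => //.
    - exact: subset_trans (le_ball le1) e1P.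
    - exact: subset_trans (le_ball le2) e2P.
    - exists (l * tau / t1).
        by rewrite divr_ge0 ?ler_pdivrMr ?mul1r ?lt1 ?mulr_ge0 // ltW.
      by rewrite line0 scalerA divfK // gt_eqF.
  right; apply: (@tube_sub B (y0 + t1 *: v) (y0 + tau *: v) e) => //.
  - exact: ball_convex.
  - exact: subset_trans (le_ball le3) e3P.
  - exact: subset_trans (le_ball le4) e4P.
  - have tt : 0 < tau - t1 by rewrite subr_gt0.
    exists ((l * tau - t1) / (tau - t1)).
      rewrite divr_ge0 ?ler_pdivrMr ?mul1r //=; [nra|lra|exact: ltW].
    rewrite [y0 + tau *: v]addrC addrKA -scalerBl scalerA divfK ?gt_eqF //.
    by rewrite -addrA -scalerDl subrKC.
pose s' z := if asbool (D1 z) then s1 z else s z.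
have gD : good D s'.
  split; [exact: tube_open|exact: tube_convex| | |].
  - by exists 0; rewrite ?lexx ?ler01 // scale0r addr0 subrr normr0.
  - by rewrite /s' asboolT.
  move=> z Dz; have [D1z|D1z] := pselect (D1 z).
    split; last by rewrite /s' asboolT //; exact: (sD _ D1z).2.
    apply: near_eq_continuous (sD _ D1z).1.
    have : nbhs z D1 by exact: open_nbhs_nbhs.
    by apply: filterS => w D1w; rewrite /s' asboolT.
  have [//|Bz] := DDB _ Dz.
  split; last by rewrite /s' asboolF //; exact: (Gs _ Bz).2.
  apply: near_eq_continuous (Gs _ Bz).1.
  have : nbhs z B by exact: open_nbhs_nbhs.
  (* On all of [B] the glued map is [s], since [s1] agrees with [s] on the overlap. *)
  apply: filterS => w Bw; rewrite /s'; have [D1w|D1w] := pselect (D1 w).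
    by rewrite asboolT // DB.
  by rewrite asboolF.
apply: (@continuous_line v tau).
have : nbhs (y0 + tau *: v) D.
  apply: open_nbhs_nbhs; split; first exact: tube_open.
  by exists 1; rewrite ?ler01 ?lexx // scale1r subrKC subrr normr0.
by apply: filterS => z Dz; exists D, s'.
Unshelve. all: by end_near. Qed.

(** The covered times along the ray from [y0] to [y] form an interval issuing from 0. If time 1 were
    not covered, its supremum would be finite and positive, and [covered_extension] there would give
    a later covered time. *)
Let covered_all y : covered y.
Proof.
have -> : y = y0 + 1 *: (y - y0) by rewrite scale1r subrKC.
set v := y - y0; apply: contrapT => ncov.
pose I := [set t : R | 0 <= t /\ covered (y0 + t *: v)].
have I1 t : I t -> t < 1.
  move=> [t0 ct]; rewrite ltNge; apply/negP => t1; apply: ncov.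
  exact: covered_star ct.
have I0 : I 0 by split=> //; rewrite scale0r addr0; exact: covered_center.
have ubI : has_ubound I by exists 1 => t /I1 /ltW.
have supI : has_sup I by split=> //; exists 0.
have [d /= d0 dP] : \forall t \near (0 : R), covered (y0 + t *: v).
  apply: (@continuous_line v 0); rewrite /= scale0r addr0.
  exact: covered_open covered_center.
have tau0 : 0 < sup I.
  apply: (@lt_le_trans _ _ (d / 2)); first by rewrite divr_gt0.
  apply: ub_le_sup => //; split; first by rewrite divr_ge0 // ltW.
  by apply: dP; rewrite /= sub0r normrN gtr0_norm ?divr_gt0 //; lra.
have [t|e /= e0 eP] := @covered_extension v (sup I) tau0.
  move=> /andP[t0 /(sup_gt (ex_intro _ 0 I0))[t' [t'0 ct'] tt']].
  exact: covered_star (ltW tt') ct'.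
have /(ub_le_sup ubI) : I (sup I + e / 2).
  split; first by rewrite addr_ge0 ?divr_ge0 ?ltW.
  by apply: eP; rewrite /= opprD addNKr normrN gtr0_norm ?divr_gt0 //; lra.
by rewrite gerDl leNgt divr_gt0.
Qed.

(** [S] is a right inverse by construction. It is a left inverse by connectedness of [T]: [S \o G]
    and the identity are two lifts of [G] that agree at [x0]. *)
Lemma global_section : exists S : V -> T,
  [/\ continuous S, cancel S G & cancel G S].
Proof.
have cS : continuous S by move=> y; exact: (covered_section (covered_all y)).1.
have SK : cancel S G by move=> y; exact: (covered_section (covered_all y)).2.
exists S; split=> // x.
have /(congr1 (fun f => f x)) : S \o G = id; last by [].
apply: (@unique_lift _ _ _ x0) => //.
- by move=> z; apply: continuous_comp; [exact: cG|exact: cS].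
- by move=> z; exact: cvg_id.
- by move=> z /=; rewrite SK.
- have [D [s [Ds Dy]]] := covered_all y0; rewrite /= (SE Ds Dy).
  by case: Ds.
Qed.

End lifting.

(** * Matrix-valued functions *)

Section matrix_limits.
Variables (R : realType) (T : Type) (F : set_system T).
Context {FF : Filter F}.

Lemma cvg_bigsum (I : Type) (r : seq I) (P : pred I) (f : I -> T -> R)
    (l : I -> R) : (forall i, P i -> f i x @[x --> F] --> l i) ->
  \sum_(i <- r | P i) f i x @[x --> F] --> \sum_(i <- r | P i) l i.
Proof.
move=> fl; elim: r => [|i r IH].
  by under eq_fun do rewrite big_nil; rewrite big_nil; exact: cvg_cst.
under eq_fun do rewrite big_cons; rewrite big_cons.
by case: ifP => // Pi; apply: cvgD IH; exact: fl.
Qed.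

Lemma cvg_bigprod (I : Type) (r : seq I) (P : pred I) (f : I -> T -> R)
    (l : I -> R) : (forall i, P i -> f i x @[x --> F] --> l i) ->
  \prod_(i <- r | P i) f i x @[x --> F] --> \prod_(i <- r | P i) l i.
Proof.
move=> fl; elim: r => [|i r IH].
  by under eq_fun do rewrite big_nil; rewrite big_nil; exact: cvg_cst.
under eq_fun do rewrite big_cons; rewrite big_cons.
by case: ifP => // Pi; apply: cvgM IH; exact: fl.
Qed.

Lemma cvg_mxP p q (f : T -> 'M[R]_(p, q)) (l : 'M[R]_(p, q)) :
  f x @[x --> F] --> l <-> forall i j, f x i j @[x --> F] --> l i j.
Proof.
split=> [fl i j|fl].
  exact: (cvg_comp _ (fun M : 'M[R]_(p, q) => M i j) fl (@coord_continuous _ _ _ i j l)).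
apply/cvg_ballP => e e0.
have : \forall x \near F, forall ij : 'I_p * 'I_q,
    ball (l ij.1 ij.2) e (f x ij.1 ij.2).
  by apply: filter_forall => -[i j] /=; have /cvg_ballP := fl i j; exact.
by apply: filterS => x fx; split=> // i j; exact: (fx (i, j)).
Qed.

Lemma cvg_mulmx p q r (f : T -> 'M[R]_(p, q)) (g : T -> 'M[R]_(q, r))
    (a : 'M[R]_(p, q)) (b : 'M[R]_(q, r)) :
  f x @[x --> F] --> a -> g x @[x --> F] --> b ->
  f x *m g x @[x --> F] --> a *m b.
Proof.
move=> /cvg_mxP fa /cvg_mxP gb; apply/cvg_mxP => i j; rewrite mxE.
under eq_fun do rewrite mxE; apply: cvg_bigsum => k _.
by apply: cvgM; [exact: fa|exact: gb].
Qed.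

Lemma cvg_trmx p q (f : T -> 'M[R]_(p, q)) (a : 'M[R]_(p, q)) :
  f x @[x --> F] --> a -> (f x)^T @[x --> F] --> a^T.
Proof.
move=> /cvg_mxP fa; apply/cvg_mxP => i j; rewrite mxE.
by under eq_fun do rewrite mxE; exact: fa.
Qed.

Lemma cvg_hs_norm p q (f : T -> 'M[R]_(p, q)) (a : 'M[R]_(p, q)) :
  f x @[x --> F] --> a -> hs_norm (f x) @[x --> F] --> hs_norm a.
Proof.
move=> /cvg_mxP fa; rewrite /hs_norm.
apply: (continuous_cvg _ (@sqrt_continuous R _)).
apply: cvg_bigsum => i _; apply: cvg_bigsum => j _.
by under eq_fun do rewrite expr2; rewrite expr2; apply: cvgM.
Qed.

Lemma cvg_det p (f : T -> 'M[R]_p) (a : 'M[R]_p) :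
  f x @[x --> F] --> a -> \det (f x) @[x --> F] --> \det a.
Proof.
move=> /cvg_mxP fa; apply: cvg_bigsum => s _.
by apply: cvgM; [exact: cvg_cst|apply: cvg_bigprod => i _; exact: fa].
Qed.

End matrix_limits.

Section matrix_derivatives.
Variables (R : realType) (V : normedModType R).
Implicit Types (t v : V).

Lemma is_derive_mxP p q (M : V -> 'M[R]_(p, q)) t v (dM : 'M[R]_(p, q)) :
  is_derive t v M dM <->
  forall i j, is_derive t v (fun x => M x i j) (dM i j).
Proof.
split=> [[dM1 <-] i j|dM1].
  split; first by have /derivable_mxP := dM1; exact.
  by rewrite derive_mx // mxE.
have dMt : derivable M t v.
  by apply/derivable_mxP => i j; exact: (@ex_derive _ _ _ _ _ _ _ (dM1 i j)).
split=> //; rewrite derive_mx //; apply/matrixP => i j; rewrite mxE.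
exact: derive_val.
Qed.

Lemma is_derive_mulmx p q r (A : V -> 'M[R]_(p, q)) (B : V -> 'M[R]_(q, r))
    t v dA dB : is_derive t v A dA -> is_derive t v B dB ->
  is_derive t v (fun x => A x *m B x) (dA *m B t + A t *m dB).
Proof.
move=> /is_derive_mxP dA' /is_derive_mxP dB'; apply/is_derive_mxP => i k.
have -> : (fun x => (A x *m B x) i k) =
    \sum_j (fun x => A x i j) * (fun x => B x j k).
  by apply/funext => x; rewrite fct_sumE mxE.
have := is_derive_sum (fun j => is_deriveM (dA' i j) (dB' j k)).
move=> h; apply: (is_derive_eq h).
rewrite !mxE -big_split /=; apply: eq_bigr => j _.
by rewrite /GRing.scale /= addrC (mulrC (B t j k)).
Qed.

Lemma is_derive_trmx p q (A : V -> 'M[R]_(p, q)) t v dA :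
  is_derive t v A dA -> is_derive t v (fun x => (A x)^T) dA^T.
Proof.
move=> /is_derive_mxP dA'; apply/is_derive_mxP => i j.
have -> : (fun x => (A x)^T i j) = (fun x => A x j i).
  by apply/funext => x; rewrite mxE.
by rewrite mxE.
Qed.

Lemma is_derive_usubmx p1 p2 q (A : V -> 'M[R]_(p1 + p2, q)) t v dA :
  is_derive t v A dA -> is_derive t v (fun x => usubmx (A x)) (usubmx dA).
Proof.
move=> /is_derive_mxP dA'; apply/is_derive_mxP => i j.
have -> : (fun x => usubmx (A x) i j) = (fun x => A x (lshift p2 i) j).
  by apply/funext => x; rewrite mxE.
by rewrite mxE.
Qed.

End matrix_derivatives.

Section hs_norm_theory.
Variable R : realType.

Lemma hs_norm_ge0 p q (A : 'M[R]_(p, q)) : 0 <= hs_norm A.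
Proof. exact: sqrtr_ge0. Qed.

Lemma sqr_hs_norm p q (A : 'M[R]_(p, q)) : hs_norm A ^+ 2 = \sum_i \sum_j A i j ^+ 2.
Proof.
by rewrite sqr_sqrtr //; apply: sumr_ge0 => i _; apply: sumr_ge0 => j _;
  exact: sqr_ge0.
Qed.

Lemma sqr_hs_norm_rV p (v : 'rV[R]_p) : hs_norm v ^+ 2 = (v *m v^T) 0 0.
Proof.
rewrite sqr_hs_norm big_ord1 mxE; apply: eq_bigr => j _.
by rewrite mxE expr2.
Qed.

Lemma hs_norm_eq0 p (v : 'rV[R]_p) : (hs_norm v == 0) = (v == 0).
Proof.
apply/eqP/eqP => [v0|->].
  have := sqr_hs_norm v; rewrite v0 expr0n /= big_ord1 => /esym.
  move/eqP; rewrite psumr_eq0 => [/allP v0'|j _]; last exact: sqr_ge0.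
  apply/rowP => j; rewrite mxE; apply/eqP; rewrite -sqrf_eq0.
  by apply: v0'; rewrite mem_index_enum.
rewrite /hs_norm big1 ?sqrtr0 // => i _; rewrite big1 // => j _.
by rewrite mxE expr0n.
Qed.

Lemma hs_normZ p q (a : R) (A : 'M[R]_(p, q)) : hs_norm (a *: A) = `|a| * hs_norm A.
Proof.
rewrite -sqrtr_sqr /hs_norm -sqrtrM ?sqr_ge0 // mulr_sumr; congr Num.sqrt.
apply: eq_bigr => i _; rewrite mulr_sumr; apply: eq_bigr => j _.
by rewrite mxE exprMn.
Qed.

Lemma cauchy_schwarz_sum (I : finType) (x y : I -> R) :
  (\sum_i x i * y i) ^+ 2 <= (\sum_i x i ^+ 2) * (\sum_i y i ^+ 2).
Proof.
set P := \sum_i x i * y i; set X := \sum_i x i ^+ 2; set Y := \sum_i y i ^+ 2.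
have Y0 : 0 <= Y by apply: sumr_ge0 => i _; exact: sqr_ge0.
have : 0 <= \sum_i (Y * x i - P * y i) ^+ 2.
  by apply: sumr_ge0 => i _; exact: sqr_ge0.
have -> : \sum_i (Y * x i - P * y i) ^+ 2 = Y * (X * Y - P ^+ 2).
  transitivity (Y ^+ 2 * X - 2 * Y * P * P + P ^+ 2 * Y); last by ring.
  transitivity (\sum_i Y ^+ 2 * x i ^+ 2 - \sum_i (2 * Y * P) * (x i * y i) +
    \sum_i P ^+ 2 * y i ^+ 2); last by rewrite -!mulr_sumr.
  by rewrite -sumrN -!big_split /=; apply: eq_bigr => i _; ring.
move: Y0; rewrite le_eqVlt => /orP[/eqP Y0 _|Y0].
  suff -> : P = 0 by rewrite -Y0 expr0n mulr0.
  rewrite /P big1 // => i _.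
  have /eqP : Y = 0 by [].
  rewrite psumr_eq0 => [/allP y0|j _]; last exact: sqr_ge0.
  have := y0 i; rewrite mem_index_enum => /(_ isT); rewrite sqrf_eq0 => /eqP ->.
  by rewrite mulr0.
by rewrite pmulr_rge0 // subr_ge0.
Qed.

(** Cauchy-Schwarz over pairs of indices, between the entries of [A] and the products
    [a 0 i * b 0 j], whose Hilbert-Schmidt norm is the product of the norms of [a] and [b]. *)
Lemma mulmx_bilin_le p q (a : 'rV[R]_p) (A : 'M[R]_(p, q)) (b : 'rV[R]_q) :
  ((a *m A *m b^T) 0 0) ^+ 2 <= (hs_norm a * hs_norm A * hs_norm b) ^+ 2.
Proof.
have -> : (a *m A *m b^T) 0 0 =
    \sum_(ij : 'I_p * 'I_q) A ij.1 ij.2 * (a 0 ij.1 * b 0 ij.2).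
  rewrite mxE -(pair_big xpredT xpredT (fun i j => A i j * (a 0 i * b 0 j))) /=.
  rewrite exchange_big /=; apply: eq_bigr => j _; rewrite !mxE mulr_suml.
  by apply: eq_bigr => i _; ring.
apply: le_trans (cauchy_schwarz_sum _ _) _.
have -> : (hs_norm a * hs_norm A * hs_norm b) ^+ 2 =
  hs_norm A ^+ 2 * (hs_norm a ^+ 2 * hs_norm b ^+ 2) by ring.
rewrite !sqr_hs_norm.
rewrite -(pair_big xpredT xpredT (fun i j => A i j ^+ 2)) /=.
rewrite -(pair_big xpredT xpredT (fun i j => (a 0 i * b 0 j) ^+ 2)) /=.
rewrite ler_wpM2l //.
  by apply: sumr_ge0 => i _; apply: sumr_ge0 => j _; exact: sqr_ge0.
rewrite !big_ord1 mulr_suml; apply: ler_sum => i _.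
by rewrite mulr_sumr; apply: ler_sum => j _; rewrite exprMn.
Qed.

End hs_norm_theory.

Lemma continuous_mulmx (R : realType) (T : topologicalType) p q r
    (f : T -> 'M[R]_(p, q)) (g : T -> 'M[R]_(q, r)) (x : T) :
  {for x, continuous f} -> {for x, continuous g} ->
  {for x, continuous (fun z => f z *m g z)}.
Proof. exact: cvg_mulmx. Qed.

Lemma continuous_mulmxr (R : realType) (T : topologicalType) p q r
    (f : T -> 'M[R]_(p, q)) (B : 'M[R]_(q, r)) (x : T) :
  {for x, continuous f} -> {for x, continuous (fun z => f z *m B)}.
Proof. by move=> cf; apply: (continuous_mulmx cf); exact: cst_continuous. Qed.

(** * Angles along frame curves *)

(** If [K] is a primitive of [k], then [K - f], [K + f] and [K] are nondecreasing on [0, 1]; the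
    last one allows passing from [s, t] to [0, 1]. *)
Lemma increment_le_integral (R : realType) (f k : R -> R) (s t : R) :
  (forall x, derivable f x 1) -> continuous k ->
  (forall x, `|derive1 f x| <= k x) -> 0 <= s -> s <= t -> t <= 1 ->
  (`|f t - f s|%:E <= \int[lebesgue_measure]_(x in `[0%R, 1%R]) (k x)%:E)%E.
Proof.
move=> df ck fk s0 st t1.
pose mu := @lebesgue_measure R.
(* The larger interval makes the primitive differentiable from both sides at 0 and at 1. *)
have int_k : mu.-integrable `[(-1)%R, 2%R] (EFin \o k).
  apply: continuous_compact_integrable; first exact: segment_compact.
  exact: continuous_subspaceT.
pose K x := (\int[mu]_(y in [set` `[-1, x]]) k y)%R.
have dK x : -1 < x < 2 -> derivable K x 1 /\ derive1 K x = k x.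
  move=> /andP[x1 x2]; exact: (continuous_FTC1_closed x2 int_k x1 (ck x)).
have -> : (\int[lebesgue_measure]_(x in `[0%R, 1%R]) (k x)%:E =
          (K 1)%:E - (K 0)%:E)%E.
  apply: continuous_FTC2 => //.
  - exact: continuous_subspaceT.
  - split.
    + by move=> x; rewrite in_itv /= => ?; apply: (dK _ _).1; lra.
    + apply: cvg_at_right_filter.
      by apply: differentiable_continuous; apply/derivable1_diffP/(dK _ _).1;
        lra.
    + apply: cvg_at_left_filter.
      by apply: differentiable_continuous; apply/derivable1_diffP/(dK _ _).1;
        lra.
  - by move=> x; rewrite in_itv /= => ?; apply: (dK _ _).2; lra.
have k0 x : 0 <= k x by exact: le_trans (fk x).
have mono (h : R -> R) : (forall x, -1 < x < 2 -> derivable h x 1) ->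
    (forall x, -1 < x < 2 -> 0 <= derive1 h x) ->
    forall a b, 0 <= a -> a <= b -> b <= 1 -> h a <= h b.
  move=> dh h0 a b a0 ab b1.
  have := @ger0_derive1_le_cc _ h 0 1; apply => //.
  - by move=> x; rewrite in_itv /= => ?; apply: dh; lra.
  - by move=> x; rewrite in_itv /= => ?; apply: h0; lra.
  - apply: derivable_within_continuous => x; rewrite in_itv /= => ?.
    by apply: dh; lra.
  - by rewrite in_itv /=; lra.
  - by rewrite in_itv /=; lra.
have Kmono := mono K (fun x hx => (dK x hx).1).
have Kf : K s - f s <= K t - f t.
  apply: (mono (fun x => K x - f x)) => // x hx.
    by apply: derivableB => //; exact: (dK _ _).1.
  rewrite derive1E deriveB //; last exact: (dK _ _).1.
  rewrite -!derive1E (dK _ hx).2.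
  by have := fk x; have := ler_norm (derive1 f x); lra.
have Kf' : K s + f s <= K t + f t.
  apply: (mono (fun x => K x + f x)) => // x hx.
    by apply: derivableD => //; exact: (dK _ _).1.
  rewrite derive1E deriveD //; last exact: (dK _ _).1.
  rewrite -!derive1E (dK _ hx).2.
  by have := fk x; have := ler_normr (- derive1 f x) (derive1 f x);
     rewrite lexx orbT => /esym h1 h2; lra.
rewrite -EFinB lee_fin ler_norml.
have K' x : -1 < x < 2 -> 0 <= derive1 K x by move=> hx; rewrite (dK _ hx).2.
have := Kmono K' 0 s; have := Kmono K' t 1.
by move=> h1 h2; have := h1 _ _ _; have := h2 _ _ _; lra.
Qed.

Section frame_curves.
Variables (R : realType) (n m : nat).
Implicit Types (E : R -> 'M[R]_(n + m)) (v : 'rV[R]_(n + m)) (t : R).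

(** The second identity says that the orthogonal projections to the plane of the first [n] rows and
    to its complement add up to the identity; it holds because a one-sided inverse of a square
    matrix is two-sided. *)
Lemma orthonormal_frame_blocks (Q : 'M[R]_(n + m)) : Q *m Q^T = 1%:M ->
  usubmx Q *m (usubmx Q)^T = 1%:M /\
  (usubmx Q)^T *m usubmx Q + (dsubmx Q)^T *m dsubmx Q = 1%:M.
Proof.
move=> Q1; have Q2 := mulmx1C Q1; split.
  move: Q1; rewrite -{1 2}[Q]vsubmxK tr_col_mx mul_col_row (scalar_mx_block n m 1).
  by move=> /eq_block_mx[].
by move: Q2; rewrite -{1 2}[Q]vsubmxK tr_col_mx mul_row_col.
Qed.

Lemma is_derive_frame_curve E (t : R) : frame_curve E ->
  is_derive t 1 E (derive1 E t).
Proof.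
move=> [[dE _] _]; rewrite derive1E; apply: derivableP.
by apply: diff_derivable; exact: dE.
Qed.

Lemma continuous_connection_form E (t : R) : frame_curve E ->
  {for t, continuous (connection_form E)}.
Proof.
move=> [[dE cE] _]; apply: cvg_mulmx.
  have -> : derive1 E = 'D_1 E by apply/funext => x; rewrite derive1E.
  exact: cE.
by apply: cvg_trmx; apply: differentiable_continuous; exact: dE.
Qed.

Lemma continuous_grassmann_speed E : frame_curve E ->
  continuous (fun t => hs_norm (ursubmx (connection_form E t))).
Proof.
move=> fE t; apply: cvg_hs_norm; apply/cvg_mxP => i j.
have ijE x : ursubmx (connection_form E x) i j =
    connection_form E x (lshift m i) (rshift n j) by rewrite mxE mxE.
under eq_fun do rewrite ijE; rewrite ijE.
by have /cvg_mxP := continuous_connection_form (t := t) fE; exact.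
Qed.

(* The squared cosine of the angle from the unit vector [v] to the plane
   spanned by the first [n] vectors of the frame. *)
Definition sqr_cos E v t := hs_norm (v *m (usubmx (E t))^T) ^+ 2.

Lemma sqr_cosD E v t : frame_curve E -> hs_norm v = 1 ->
  sqr_cos E v t + hs_norm (v *m (dsubmx (E t))^T) ^+ 2 = 1.
Proof.
move=> [_ E1] v1; have [_ AB] := orthonormal_frame_blocks (E1 t).
have sq p (C : 'M[R]_(p, n + m)) :
    hs_norm (v *m C^T) ^+ 2 = (v *m (C^T *m C) *m v^T) 0 0.
  by rewrite sqr_hs_norm_rV trmx_mul trmxK !mulmxA.
rewrite /sqr_cos !sq -[RHS](expr1n R 2) -v1 sqr_hs_norm_rV.
transitivity ((v *m 1%:M *m v^T) 0 0); last by rewrite mulmx1.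
by rewrite -AB mulmxDr mulmxDl [RHS]mxE.
Qed.

Lemma sqr_cos_itv E v t : frame_curve E -> hs_norm v = 1 ->
  0 <= sqr_cos E v t <= 1.
Proof.
by move=> fE v1; rewrite -(sqr_cosD t fE v1) lerDl !sqr_ge0.
Qed.

(* Only the off-diagonal block of the connection form contributes to the
   derivative, the diagonal block being skew. *)
Lemma derive_sqr_cos E v (t : R) : frame_curve E -> hs_norm v = 1 ->
  exists2 dg : R, is_derive t 1 (sqr_cos E v) dg &
    dg ^+ 2 <= 4 * hs_norm (ursubmx (connection_form E t)) ^+ 2 *
               (sqr_cos E v t * (1 - sqr_cos E v t)).
Proof.
move=> fE v1; have [_ E1] := fE; have [AA AB] :=
  orthonormal_frame_blocks (E1 t).
have dE := is_derive_frame_curve t fE.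
pose A s := usubmx (E s); pose B s := dsubmx (E s); pose A' :=
  usubmx (derive1 E t).
have dA : is_derive t 1 A A' by exact: is_derive_usubmx.
pose a s := v *m (A s)^T.
have da : is_derive t 1 a (v *m A'^T).
  apply: is_derive_eq.
    exact: (is_derive_mulmx (is_derive_cst v t 1) (is_derive_trmx dA)).
  by rewrite mul0mx add0r.
have gE : sqr_cos E v = (fun s => (a s *m (a s)^T) 0 0).
  by apply/funext => s; rewrite /sqr_cos sqr_hs_norm_rV.
(* This is the derivative of [A s *m (A s)^T], which is constantly the identity. *)
have skew : A' *m (A t)^T + A t *m A'^T = 0.
  have d1 := is_derive_mulmx dA (is_derive_trmx dA).
  have d2 : is_derive t 1 (fun s => A s *m (A s)^T) 0.
    have -> : (fun s => A s *m (A s)^T) = cst 1%:M.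
      by apply/funext => s; have [] := orthonormal_frame_blocks (E1 s).
    exact: is_derive_cst.
  by rewrite -(derive_val (is_derive := d1)) (derive_val (is_derive := d2)).
have skew0 : (a t *m (A' *m (A t)^T) *m (a t)^T) 0 0 = 0.
  set S := A' *m (A t)^T; set x := (LHS).
  have ST : S^T = - S.
    by apply/eqP; rewrite -addr_eq0 addrC trmx_mul trmxK; apply/eqP.
  have : x = - x.
    rewrite {1}/x -[in LHS](trmxK (a t *m S *m (a t)^T)) mxE.
    by rewrite trmx_mul trmxK [(a t *m S)^T]trmx_mul ST mulmxA mulmxN mulNmx mxE.
  by lra.
pose w := ursubmx (connection_form E t).
have wE : w = A' *m (B t)^T.
  rewrite /w /connection_form -{1}[derive1 E t]vsubmxK -{1}[E t]vsubmxK.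
  by rewrite tr_col_mx mul_col_row block_mxKur.
(* Splitting [v] along the plane and its complement separates the skew term, which vanishes, from
   the term in [w]. *)
have a'E : a t *m A' *m v^T = a t *m (A' *m (A t)^T) *m (a t)^T +
    a t *m w *m (v *m (B t)^T)^T.
  rewrite -[in LHS](mulmx1 (a t *m A')) -AB wE !trmx_mul !trmxK.
  by rewrite mulmxDr mulmxDl !mulmxA.
exists (2 * (a t *m w *m (v *m (B t)^T)^T) 0 0).
  rewrite gE; have /is_derive_mxP := is_derive_mulmx da (is_derive_trmx da).
  move=> /(_ 0 0) h; apply: (is_derive_eq h); rewrite mxE.
  have -> : (v *m A'^T *m (a t)^T) 0 0 = (a t *m (v *m A'^T)^T) 0 0.
    transitivity ((v *m A'^T *m (a t)^T)^T 0 0); first by rewrite [RHS]mxE.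
    by rewrite [(_ *m (a t)^T)^T]trmx_mul trmxK.
  rewrite trmx_mul trmxK mulmxA a'E mxE skew0; ring.
rewrite exprMn; apply: le_trans (ler_wpM2l _ (mulmx_bilin_le _ _ _)) _.
  by rewrite sqr_ge0.
have -> : 1 - sqr_cos E v t = hs_norm (v *m (B t)^T) ^+ 2.
  by rewrite -[X in X - _](sqr_cosD t fE v1) addrC addKr.
by rewrite /sqr_cos -/(A t) -/(a t) le_eqVlt; apply/orP; left; apply/eqP; ring.
Qed.

(* The factor [k < 1] keeps the argument of [acos] away from its
   singularities. *)
Lemma angle_le_grassmann_length E v (k : R) : frame_curve E -> hs_norm v = 1 ->
  0 < k < 1 ->
  ((`|acos (k * (2 * sqr_cos E v 1 - 1)) - acos (k * (2 * sqr_cos E v 0 - 1))|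
      / 2)%:E <= grassmann_length E)%E.
Proof.
move=> fE v1 /andP[k0 k1].
(* Twice the squared cosine minus 1 is the cosine of the double angle; hence the division by 2 in
   the bound. *)
pose z t := k * (2 * sqr_cos E v t - 1).
have z_itv t : -1 < z t < 1.
  have /andP[g0 g1] := sqr_cos_itv t fE v1.
  by rewrite /z; apply/andP; split; nra.
have dz t : exists2 d : R, is_derive t 1 (@acos R \o z) d &
    `|d| <= 2 * hs_norm (ursubmx (connection_form E t)).
  have [dg dgE dgle] := derive_sqr_cos t fE v1.
  set w := hs_norm _ in dgle *.
  have dzt : is_derive t 1 z (k * (2 * dg)).
    have -> : z = k \*: (2 \*: sqr_cos E v - cst 1) by apply/funext.
    by apply: is_derive_eq; rewrite subr0.
  exists (- (Num.sqrt (1 - z t ^+ 2))^-1 * (k * (2 * dg))).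
    exact: (is_derive1_comp (is_derive1_acos (z_itv t)) dzt).
  have /andP[z1 z2] := z_itv t.
  have s0 : 0 < 1 - z t ^+ 2 by nra.
  rewrite normrM normrN normfV (gtr0_norm (x := Num.sqrt _)) ?sqrtr_gt0 //.
  rewrite ler_pdivrMl ?sqrtr_gt0 //.
  have w0 : 0 <= w by exact: hs_norm_ge0.
  rewrite -(@ler_pXn2r _ 2) ?nnegrE ?mulr_ge0 ?sqrtr_ge0 //.
  rewrite real_normK ?num_real // [leRHS]exprMn sqr_sqrtr ?(ltW s0) //.
  rewrite /z; set g := sqr_cos E v t in dgle *.
  have /andP[g0 g1] : 0 <= g <= 1 by exact: sqr_cos_itv.
  have h1 : (k * (2 * dg)) ^+ 2 <= 4 * k ^+ 2 * (4 * w ^+ 2 * (g * (1 - g))).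
    have -> : (k * (2 * dg)) ^+ 2 = 4 * k ^+ 2 * dg ^+ 2 by ring.
    by rewrite ler_wpM2l // mulr_ge0 // sqr_ge0.
  apply: le_trans h1 _.
  have -> : (1 - (k * (2 * g - 1)) ^+ 2) * (2 * w) ^+ 2 =
    4 * k ^+ 2 * (4 * w ^+ 2 * (g * (1 - g))) + 4 * w ^+ 2 * (1 - k ^+ 2)
      by ring.
  by rewrite lerDl mulr_ge0 ?mulr_ge0 ?sqr_ge0 // subr_ge0 expr_le1 // ltW.
pose f t := 2^-1 * acos (z t).
have df t : exists2 d : R, is_derive t 1 f d &
    `|d| <= hs_norm (ursubmx (connection_form E t)).
  have [d dd dle] := dz t; exists (2^-1 * d).
    have -> : f = 2^-1 \*: (@acos R \o z) by [].
    by apply: is_derive_eq.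
  by rewrite normrM ger0_norm ?invr_ge0 // mulrC ler_pdivrMr // mulrC.
have -> : `|acos (k * (2 * sqr_cos E v 1 - 1)) -
    acos (k * (2 * sqr_cos E v 0 - 1))| / 2 = `|f 1 - f 0|.
  by rewrite /f -mulrBr normrM ger0_norm ?invr_ge0 // mulrC.
have df1 t : derivable f t 1.
  by have [d dd _] := df t; exact: (@ex_derive _ _ _ _ _ _ _ dd).
have df2 t : `|derive1 f t| <= hs_norm (ursubmx (connection_form E t)).
  by have [d dd] := df t; rewrite derive1E (derive_val (is_derive := dd)).
exact: (increment_le_integral df1 (continuous_grassmann_speed fE) df2
  (lexx 0) ler01 (lexx 1)).
Qed.

(** A unit vector of the final plane has angle 0 at time 1, and its angle changes by less than [a]
    in total; this bounds its squared cosine at time 0 from below by a constant that depends on [a]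
    only. *)
Lemma short_frame_curve_projection (a : R) : 0 <= a < pi / 2 -> exists2 c : R,
  0 < c & forall E, frame_curve E -> (grassmann_length E < a%:E)%E ->
  forall w : 'rV[R]_n, c * hs_norm (w *m usubmx (E 1)) <=
    hs_norm (w *m usubmx (E 1) *m (usubmx (E 0))^T).
Proof.
(* With the factor k = [cos d], the distorted double angle is [d] at time 1, hence below d + 2a = pi
   - 3d at time 0. Solving [cos d * (2 * g - 1) > - cos (3 * d)] for [g] gives the bound [c2],
   positive because [cos (3 * d) < cos d]. *)
move=> /andP[a0 api]; pose d := (pi - 2 * a) / 4 : R.
have d0 : 0 < d by rewrite /d divr_gt0 //; lra.
have d4 : 4 * d = pi - 2 * a by rewrite /d; field.
have dpi : 4 * d <= pi by lra.
have in0pi (x : R) : 0 <= x <= pi -> x \in `[0, pi] by rewrite in_itv.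
have k0 : 0 < cos d by apply: cos_gt0_pihalf; lra.
have k1 : cos d < 1 by rewrite -(@cos0 R) ltr_cos ?in0pi //; lra.
have k3 : cos (3 * d) < cos d by rewrite ltr_cos ?in0pi //; lra.
pose c2 := (1 - cos (3 * d) / cos d) / 2.
have c20 : 0 < c2 by rewrite /c2 divr_gt0 // subr_gt0 ltr_pdivrMr // mul1r.
exists (Num.sqrt c2); first by rewrite sqrtr_gt0.
move=> E fE La w; set u := w *m _.
have [u0|u0] := eqVneq (hs_norm u) 0; first by rewrite u0 mulr0 hs_norm_ge0.
have uE : u = hs_norm u *: ((hs_norm u)^-1 *: u)
  by rewrite scalerA divff // scale1r.
have up : 0 < hs_norm u by rewrite lt_neqAle eq_sym u0 hs_norm_ge0.
pose v := (hs_norm u)^-1 *: u.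
have v1 : hs_norm v = 1
  by rewrite hs_normZ ger0_norm ?invr_ge0 ?mulVf ?hs_norm_ge0.
have [AA _] := orthonormal_frame_blocks (fE.2 1).
have wu : hs_norm w = hs_norm u.
  apply/eqP; rewrite -(@eqrXn2 _ 2) ?hs_norm_ge0 // !sqr_hs_norm_rV.
  by rewrite /u trmx_mul mulmxA -(mulmxA w) AA mulmx1.
have g1 : sqr_cos E v 1 = 1.
  rewrite /sqr_cos -scalemxAl -mulmxA AA mulmx1 hs_normZ wu -hs_normZ.
  by rewrite -/v v1 expr1n.
have /andP[gle0 gle1] := sqr_cos_itv 0 fE v1.
suff gc : c2 <= sqr_cos E v 0.
  rewrite [in leRHS]uE -scalemxAl hs_normZ (ger0_norm (hs_norm_ge0 u)) mulrC.
  rewrite ler_pM2l // -(ger0_norm (hs_norm_ge0 (_ *m _))) -sqrtr_sqr.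
  by rewrite ler_wsqrtr.
have k01 : 0 < cos d < 1 by rewrite k0.
have := le_lt_trans (angle_le_grassmann_length fE v1 k01) La.
rewrite g1 mulr1 (_ : 2 - 1 = 1); last by ring.
rewrite mulr1 cosK ?in0pi //; last by lra.
set g := sqr_cos E v 0 in gle0 gle1 *; set z := cos d * (2 * g - 1).
have z_itv : -1 <= z <= 1 by rewrite /z; apply/andP; split; nra.
have [/andP[az0 az1] zE] := acos_def z_itv.
rewrite lte_fin ltr_pdivrMr // distrC => /(le_lt_trans (ler_norm _)) azlt.
have : cos (pi - 3 * d) < z by rewrite -zE ltr_cos ?in0pi //; lra.
rewrite cosB cospi sinpi mul0r addr0 mulN1r /z => hz.
rewrite /c2 ler_pdivrMr // -(ler_pM2r k0) mulrBl divfK ?gt_eqF //.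
lra.
Qed.

Lemma geodesic_ball_projection (P0 : set 'M[R]_(n, n + m)) (a : R) :
  0 <= a < pi / 2 -> grassmannian R n (n + m) P0 ->
  geodesic_ball P0 a !=set0 ->
  exists2 c : R, 0 < c & exists2 Q : 'M[R]_(n, n + m), Q *m Q^T = 1%:M &
  forall A, geodesic_ball P0 a (oriented_span A) ->
  forall w : 'rV[R]_n, c * hs_norm (w *m A) <= hs_norm (w *m A *m Q^T).
Proof.
move=> api [A0 _ <-] [P [_ distP]].
have curve P' : (grassmann_dist (oriented_span A0) P' < a%:E)%E ->
    exists E, [/\ frame_curve E, oriented_span A0 (usubmx (E 0)), P' (usubmx (E 1))
      & (grassmann_length E < a%:E)%E].
  by move=> /ereal_inf_lt[_ [E [fE E0 E1 ->]] lE]; exists E.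
have [c c0 cP] := short_frame_curve_projection api; exists c => //.
(* A point of the ball supplies a frame curve from [P0], and its initial frame an orthonormal basis
   of the centre. *)
have [E [fE [B B0 QE] _ _]] := curve _ distP.
have [QQ _] := orthonormal_frame_blocks (fE.2 0).
exists (usubmx (E 0)) => // A [_ /curve[E' [fE' [B' _ QE'] [C C0 AE] lE']]] w.
have det_unit (D : 'M[R]_n) : 0 < \det D -> D \in unitmx.
  by move=> D0; rewrite unitmxE unitfE gt_eqF.
have := cP _ fE' lE' (w *m invmx C).
rewrite -AE mulmxA mulmxKV ?det_unit // => /le_trans; apply.
have [QQ' _] := orthonormal_frame_blocks (fE'.2 0).
(* Different curves may start from different orthonormal bases of [P0]; the change of basis [D] is
   orthogonal and preserves the norm of the projection. *)
have [D DQ] : exists D, usubmx (E' 0) = D *m usubmx (E 0).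
  by exists (B' *m invmx B); rewrite -QE -QE' mulmxA mulmxKV ?det_unit.
have DD : D^T *m D = 1%:M.
  by apply: mulmx1C; rewrite -QQ' DQ trmx_mul mulmxA -(mulmxA D) QQ mulmx1.
rewrite DQ trmx_mul mulmxA; set x := w *m A *m _.
rewrite -(ler_pXn2r (n := 2)) ?nnegrE ?hs_norm_ge0 // !sqr_hs_norm_rV.
by rewrite trmx_mul trmxK mulmxA -(mulmxA x) DD mulmx1.
Qed.

End frame_curves.

(** * Local inversion *)

Lemma is_derive_comp_jacobian (R : realType) p q (g : 'rV[R]_p -> 'rV[R]_q)
    (c : R -> 'rV[R]_p) (t : R) (dc : 'rV[R]_p) :
  differentiable g (c t) -> is_derive t 1 c dc ->
  is_derive t 1 (g \o c) (dc *m 'J g (c t)).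
Proof.
move=> dg [dc1 dcE].
have dct : differentiable c t by apply/derivable1_diffP.
have dgc : differentiable (g \o c) t by exact: differentiable_comp.
split; first exact/derivable1_diffP.
by rewrite -dcE -(deriveEjacobian ('D_1 c t) dg) !deriveE // diff_comp.
Qed.

Lemma rV_norm_le (R : realType) n (v : 'rV[R]_n) (r : R) : 0 <= r ->
  (forall j, `|v 0 j| <= r) -> `|v| <= r.
Proof.
move=> r0 vr; rewrite leNgt; apply/negP => /(rV_norm_coord r0)[j].
by rewrite ltNge vr.
Qed.

Lemma jacobian_row (R : realType) p q (g : 'rV[R]_p -> 'rV[R]_q) u i :
  differentiable g u -> row i ('J g u) = 'D_(delta_mx 0 i) g u.
Proof. by move=> dg; rewrite rowE deriveEjacobian. Qed.

Lemma continuous_jacobian (R : realType) p q (U : set 'rV[R]_p)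
    (g : 'rV[R]_p -> 'rV[R]_q) (u : 'rV[R]_p) : open U -> Ck_on 1 U g -> U u ->
  {for u, continuous (fun w => 'J g w)}.
Proof.
move=> oU [dg cg] Uu.
apply/(@cvg_mxP R _ (nbhs u) _ _ _ (fun w => 'J g w)) => i j.
have rowJ w : U w -> 'J g w i j = 'D_(delta_mx 0 i) g w 0 j.
  by move=> Uw; rewrite -jacobian_row ?mxE //; exact: dg.
have h := @continuous_comp _ _ _ ('D_(delta_mx 0 i) g)
  (fun M : 'rV[R]_q => M 0 j) u (cg _ _ Uu) (@coord_continuous _ _ _ 0 j _).
apply: (@near_eq_continuous _ _ _ (fun w => 'J g w i j) _ _ h).
have : nbhs u U by exact: open_nbhs_nbhs.
by apply: filterS => w Uw; rewrite rowJ.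
Qed.

Lemma is_derive_line (R : realType) p (w v : 'rV[R]_p) (t : R) :
  is_derive t 1 (fun t : R => w + t *: v) v.
Proof.
apply/is_derive_mxP => i j.
have -> : (fun x : R => (w + x *: v) i j) = cst (w i j) + (v i j \*: @id R).
  by apply/funext => x; rewrite !mxE mulrC.
have dv := is_deriveZ (v i j) (is_derive_id t (1 : R)).
apply: (is_derive_eq (is_deriveD (is_derive_cst (w i j) t (1 : R)) dv)).
by rewrite add0r /GRing.scale /= mulr1.
Qed.

Section local_inverse.
Variables (R : realType) (n : nat) (U : set 'rV[R]_n).
Variables (g : 'rV[R]_n -> 'rV[R]_n) (u0 : 'rV[R]_n).
Hypotheses (oU : open U) (Uu0 : U u0) (g1 : Ck_on 1 U g).
Hypothesis J_unit : 'J g u0 \in unitmx.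

Let Ji := invmx ('J g u0).

(** The map [g u *m Ji - u] has derivative [D u], which is continuous at [u0] and vanishes there;
    the mean value theorem is applied to each coordinate along the segment from [w] to [u]. The
    estimate serves local injectivity, local surjectivity and the differentiability of lifts. *)
Lemma jacobian_near_const (eps : R) : 0 < eps ->
  exists2 r : R, 0 < r & ball u0 r `<=` U /\
  forall u w : 'rV[R]_n, ball u0 r u -> ball u0 r w ->
    `|(g u - g w) *m Ji - (u - w)| <= eps * `|u - w|.
Proof.
move=> eps0.
pose D u : 'M[R]_n := 'J g u *m Ji - 1%:M.
(* In the sup norm, multiplication by a matrix with entries at most [e] enlarges a row at most by
   the factor n e; [n.+1] keeps the denominator nonzero when n is 0. *)
pose e : R := eps / n.+1%:R.
have e0 : 0 < e by rewrite divr_gt0.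
have cD : {for u0, continuous D}.
  have cJ : {for u0, continuous (fun u => 'J g u *m Ji)}.
    exact: (continuous_mulmxr (continuous_jacobian oU g1 Uu0)).
  by apply: (continuousB cJ (g := cst 1%:M)); exact: cst_continuous.
have D0 : D u0 = 0 by rewrite /D mulmxV // subrr.
have /nbhs_ballP[r /= r0 rP] : \forall u \near u0, U u /\ ball (D u0) e (D u).
  apply: filterI; first exact: open_nbhs_nbhs.
  by apply: cD; exact: nbhsx_ballx.
have rP' (u : 'rV[R]_n) : ball u0 r u -> U u /\ forall i j, `|D u i j| <= e.
  move=> /rP[Uu [_ De]]; split=> // i j.
  by have := De i j; rewrite D0 -ball_normE /= mxE sub0r normrN => /ltW.
exists r => //; split=> [u /rP'[]//|u w Bu Bw].
pose v := u - w; pose c (t : R) := w + t *: v.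
have Bc (t : R) : 0 <= t <= 1 -> ball u0 r (c t).
  by move=> t01; exact: ball_convex.
have dc (t : R) : is_derive t 1 c v by exact: is_derive_line.
have dk (t : R) : 0 <= t <= 1 ->
    is_derive t 1 (fun t => (g (c t)) *m Ji - c t) (v *m D (c t)).
  move=> t01; have [Uc _] := rP' _ (Bc _ t01).
  have dgc := is_derive_comp_jacobian (g1.1 _ Uc) (dc t).
  apply: is_derive_eq.
    exact: is_deriveB (is_derive_mulmx dgc (is_derive_cst Ji t 1)) (dc t).
  by rewrite mulmx0 addr0 /D mulmxBr mulmx1 mulmxA.
have c0 : c 0 = w by rewrite /c scale0r addr0.
have c1 : c 1 = u by rewrite /c scale1r subrKC.
apply: rV_norm_le => [|j]; first by rewrite mulr_ge0 // ltW.
have dkj (t : R) : 0 <= t <= 1 ->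
    is_derive t 1 (fun t => (g (c t) *m Ji - c t) 0 j) ((v *m D (c t)) 0 j).
  by move=> /dk /is_derive_mxP.
have [||x] := MVT_segment (f := fun t => (g (c t) *m Ji - c t) 0 j)
    (df := fun t => (v *m D (c t)) 0 j) (@ler01 R).
- by move=> x; rewrite in_itv /= => /andP[x0 x1]; apply: dkj; rewrite !ltW.
- apply: derivable_within_continuous => x; rewrite in_itv /= => x01.
  exact: (@ex_derive _ _ _ _ _ _ _ (dkj _ x01)).
rewrite in_itv /= => x01; rewrite c1 c0 subr0 mulr1 => xE.
have -> : ((g u - g w) *m Ji - (u - w)) 0 j = (v *m D (c x)) 0 j.
  by rewrite -xE mulmxBl !mxE; ring.
have [_ De] := rP' _ (Bc _ x01).
rewrite mxE; apply: le_trans (ler_norm_sum _ _ _) _.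
apply: (@le_trans _ _ (\sum_(i < n) `|v| * e)).
  apply: ler_sum => i _; rewrite normrM; apply: ler_pM => //.
  exact: rV_coord_le_norm.
rewrite sumr_const card_ord -[leLHS]mulr_natr -[leLHS]mulrA mulrC ler_wpM2r //.
rewrite /e mulrAC -mulrA ler_piMr ?(ltW eps0) // ler_pdivrMr // mul1r ler_nat.
exact: leqnSn.
Qed.

(** With eps = 1/2 in the previous estimate, [g] is injective on the ball, and [g u = y] is solved
    by the fixed point of [phi], the step of Newton's method with the derivative frozen at [u0]. *)
Lemma local_inverse : exists2 r : R, 0 < r &
  [/\ ball u0 r `<=` U,
      forall u w : 'rV[R]_n, ball u0 r u -> ball u0 r w -> g u = g w -> u = w &
      exists2 rho : R, 0 < rho & exists2 s : 'rV[R]_n -> 'rV[R]_n,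
        s (g u0) = u0 &
        forall y : 'rV[R]_n, ball (g u0) rho y ->
          [/\ ball u0 r (s y), g (s y) = y & {for y, continuous s}]].
Proof.
have [r r0 [rU rP]] := jacobian_near_const (divr_gt0 ltr01 (ltr0Sn R 1));
  exists r => //.
have inj (u w : 'rV[R]_n) : ball u0 r u -> ball u0 r w -> g u = g w -> u = w.
  move=> Bu Bw guw; have := rP _ _ Bu Bw.
  rewrite guw subrr mul0mx sub0r normrN mul1r => uw.
  by apply/eqP; rewrite -subr_eq0 -normr_le0; have := normr_ge0 (u - w); lra.
split=> //.
have cJ (y : 'rV[R]_n) : {for y, continuous (fun z : 'rV[R]_n => (z - y) *m Ji)}.
  apply: (@continuous_mulmxr _ _ _ _ _ (fun z : 'rV[R]_n => z - y)).
  apply: (@continuousB _ _ _ id (cst y)); [by []|exact: cst_continuous].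
have near0 (y : 'rV[R]_n) e : 0 < e -> \forall z \near y, `|(z - y) *m Ji| < e.
  move=> e0.
  have : \forall z \near y, ball ((y - y) *m Ji) e ((z - y) *m Ji).
    by apply: (@cJ y); exact: nbhsx_ballx.
  by apply: filterS => z; rewrite -ball_normE /= subrr mul0mx sub0r normrN.
(* For such [y], [phi] maps the closed ball of radius [r / 2] to itself: it moves the centre by less
   than [r / 4], and the contraction factor 1/2 adds at most another [r / 4]. *)
have /nbhs_ballP[rho /= rho0 rhoP] :=
  near0 (g u0) (r / 4) (divr_gt0 r0 (ltr0Sn _ _)).
exists rho => //.
pose K : set 'rV[R]_n := closed_ball_ Num.norm u0 (r / 2).
have KB : K `<=` ball u0 r.
  by move=> u; rewrite -ball_normE /K /closed_ball_ /= => /le_lt_trans; apply;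
    lra.
have sol (y : 'rV[R]_n) : ball (g u0) rho y -> exists2 u, K u & g u = y.
  move=> /rhoP ry.
  pose phi (u : 'rV[R]_n) := u - (g u - y) *m Ji.
  have lip (u w : 'rV[R]_n) : K u -> K w ->
    `|phi u - phi w| <= 1 / 2 * `|u - w|.
    move=> /KB Bu /KB Bw; rewrite -normrN; have := rP _ _ Bu Bw.
    congr (`|_| <= _); rewrite /phi !mulmxBl.
    by apply/rowP => j; rewrite !mxE; ring.
  have phiK : set_fun K K phi.
    move=> u Ku; rewrite /K /closed_ball_ /=.
    have Ku0 : K u0 by rewrite /K /closed_ball_ /= subrr normr0 divr_ge0 // ltW.
    have -> : u0 - phi u = - (phi u - phi u0) - (y - g u0) *m Ji.
      by rewrite /phi !mulmxBl; apply/rowP => j; rewrite !mxE; ring.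
    apply: le_trans (ler_normB _ _) _; rewrite normrN.
    have := lip _ _ Ku Ku0; move: Ku; rewrite /K /closed_ball_ /= distrC => ? ?.
    by move: ry; lra.
  have ctr : is_contraction (mkfun_fun phiK).
    exists (1 / 2)%:nng; split; first by rewrite /= mul1r invf_lt1 // ltr1n.
    by move=> [u w] [/= Ku Kw]; exact: lip.
  pose X : completeNormedModType R :=
    HB.pack_for (completeNormedModType R) 'rV[R]_n (Complete.on 'rV[R]_n).
  have [||u Ku phiu] := @banach_fixed_point R X K (mkfun_fun phiK) ctr.
  - exact: closed_closed_ball_.
  - by exists u0; rewrite /K /closed_ball_ /= subrr normr0 divr_ge0 // ltW.
  exists u => //; apply/eqP; rewrite -subr_eq0.
  have : (g u - y) *m Ji = 0.
    by move: phiu => /= /eqP; rewrite -subr_eq0 /phi opprB addrC subrK => /eqP.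
  by move=> /(congr1 (mulmx^~ ('J g u0))); rewrite mulmxKV // mul0mx => ->.
pose s (y : 'rV[R]_n) := xget u0 [set u | K u /\ g u = y].
have sP (y : 'rV[R]_n) : ball (g u0) rho y -> K (s y) /\ g (s y) = y.
  by move=> /sol[u Ku gu]; apply: (@xgetPex _ u0 [set u | K u /\ g u = y]);
    exists u.
have gB : ball (g u0) rho (g u0) by exact: ballxx.
exists s.
  by apply: inj; [exact/KB/(sP _ gB).1|exact: ballxx|exact: (sP _ gB).2].
move=> y By; have [Ky gy] := sP _ By; split=> //; first exact: KB.
move=> A /nbhs_ballP[e /= e0 eA].
have e2 : 0 < e / 2 by rewrite divr_gt0.
have yB : \forall z \near y, ball (g u0) rho z.
  by apply: open_nbhs_nbhs; split=> //; exact: ball_open.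
suff : \forall z \near y, ball (s y) e (s z) by apply: filterS => z; exact: eA.
near=> z; rewrite -ball_normE /=.
have Bz : ball (g u0) rho z by near: z.
have [Kz gz] := sP _ Bz.
have := rP _ _ (KB _ Kz) (KB _ Ky); rewrite gy gz => h.
have zy : `|(z - y) *m Ji| < e / 2 by near: z; exact: near0.
rewrite distrC.
have : `|s z - s y| <= `|(z - y) *m Ji| + `|(z - y) *m Ji - (s z - s y)|.
  rewrite -[X in `|X| <= _](subKr ((z - y) *m Ji)); exact: ler_normB.
lra.
Unshelve. all: by end_near. Qed.

(** The local inverse is only known to be continuous, so a continuous lift is differentiated by
    hand. The difference quotients [D h] of the lift differ from those of its image times [Ji],
    called [Q h], by at most [eps] times their own norm; so they stay bounded and, [eps] being
    arbitrary, have the same limit. *)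
Lemma is_derive_lift (c : R -> 'rV[R]_n) (t : R) (dp : 'rV[R]_n) :
  c t = u0 -> {for t, continuous c} -> is_derive t 1 (g \o c) dp ->
  is_derive t 1 c (dp *m Ji).
Proof.
move=> ct cc [dgc dgcE].
pose Q (h : R) := (h^-1 *: ((g \o c) (h *: 1 + t) - (g \o c) t)) *m Ji.
have cvgQ : Q h @[h --> 0^'] --> dp *m Ji.
  apply: cvg_mulmx; last exact: cvg_cst.
  by rewrite -dgcE; exact: dgc.
suff cvgc : h^-1 *: ((c \o shift t) (h *: 1) - c t) @[h --> 0^'] --> dp *m Ji.
  split; first by apply/cvg_ex; exists (dp *m Ji).
  by apply: cvg_lim => //; exact: norm_hausdorff.
pose D (h : R) : 'rV[R]_n := h^-1 *: (c (h *: 1 + t) - c t).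
have -> : (fun h : R => h^-1 *: ((c \o shift t) (h *: 1) - c t)) = D by [].
pose B := `|dp *m Ji| + 1.
have B0 : 0 < B by rewrite ltr_wpDl.
have QB : \forall h \near 0^', `|Q h| < B.
  by apply: (cvgr_norm_lt _ cvgQ); rewrite ltrDl.
apply: (iffRL (cvgrPdist_lt D (dp *m Ji))) => eta eta0.
(* The bound 1/2 gives [|D h| <= 2 * |Q h|], which is below 2B; the other bound then keeps the error
   at most [eta / 2]. *)
pose eps := Num.min (1 / 2) (eta / (4 * B)).
have eps0 : 0 < eps by rewrite lt_min !divr_gt0 ?mulr_gt0.
have [r r0 [_ rP]] := jacobian_near_const eps0.
have cB : \forall h \near 0^', ball u0 r (c (h *: 1 + t)).
  have : \forall z \near t, ball u0 r (c z) by apply: cc; rewrite ct;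
    exact: nbhsx_ballx.
  move=> /nbhs_ballP[d /= d0 dP]; near=> h; apply: dP.
  rewrite -ball_normE /= opprD addrCA subrr addr0 normrN /GRing.scale /= mulr1.
  by near: h; exact: dnbhs0_lt.
have QE : \forall h \near 0^', `|dp *m Ji - Q h| < eta / 2.
  by move/cvgrPdist_lt: cvgQ; apply; rewrite divr_gt0.
near=> h.
have hB : ball u0 r (c (h *: 1 + t)) by near: h.
have hQ : `|Q h| < B by near: h.
have hE : `|dp *m Ji - Q h| < eta / 2 by near: h.
have QD : `|Q h - D h| <= eps * `|D h|.
  have := rP _ _ hB (ballxx _ r0).
  rewrite -[in X in _ * X]ct /Q /D /= ct => le1.
  rewrite -scalemxAl -scalerBr !normrZ mulrCA ler_wpM2l //.
have DQ : `|D h| <= 2 * `|Q h|.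
  have : `|D h| <= `|Q h| + `|Q h - D h|.
    by rewrite -[X in `|X| <= _](subKr (Q h)); exact: ler_normB.
  have e1 : eps <= 1 / 2 by rewrite ge_min lexx.
  have : eps * `|D h| <= 1 / 2 * `|D h| by rewrite ler_wpM2r.
  by move: QD; lra.
have e2 : eps * (4 * B) <= eta.
  by rewrite -ler_pdivlMr ?mulr_gt0 // ge_min lexx orbT.
have : `|dp *m Ji - D h| <= `|dp *m Ji - Q h| + `|Q h - D h|.
  by rewrite -[X in `|X| <= _](subrKA (Q h)) ; exact: ler_normD.
have : eps * `|D h| <= eps * (2 * B).
  by rewrite ler_wpM2l ?(ltW eps0) //; lra.
by lra.
Unshelve. all: by end_near. Qed.

End local_inverse.

(** * The projection of a submanifold to a plane *)

(** Cramer's formula is continuous in the entries; [invmx] is given by it at invertible matrices,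
    whence the hypothesis near [x]. *)
Lemma continuous_invmx (R : realType) (T : topologicalType) p (f : T -> 'M[R]_p)
    (x : T) : {for x, continuous f} -> (\forall z \near x, f z \in unitmx) ->
  {for x, continuous (fun z => invmx (f z))}.
Proof.
move=> cf fu; have fxu := nbhs_singleton fu.
have cf' : forall i j, f z i j @[z --> x] --> f x i j by apply/cvg_mxP.
apply: (@near_eq_continuous _ _ (fun z => (\det (f z))^-1 *: \adj (f z))).
  by apply: filterS fu => z fzu; rewrite /invmx fzu.
apply: (iffRL (cvg_mxP _ _)) => i j.
under eq_fun do rewrite mxE; rewrite mxE; apply: cvgM.
  by apply: cvgV; [rewrite -unitfE -unitmxE|exact: cvg_det].
under eq_fun do rewrite mxE; rewrite mxE /cofactor; apply: cvgM.
  exact: cvg_cst.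
apply: cvg_det; apply: (iffRL (cvg_mxP _ _)) => k l.
by under eq_fun do rewrite !mxE; rewrite !mxE; exact: cf'.
Qed.

Lemma is_derive_mulmxr (R : realType) (V : normedModType R) p q r
    (f : V -> 'M[R]_(p, q)) (B : 'M[R]_(q, r)) (t v : V) df :
  is_derive t v f df -> is_derive t v (fun x => f x *m B) (df *m B).
Proof.
move=> dft; apply: (is_derive_eq (is_derive_mulmx dft (is_derive_cst B t v))).
by rewrite mulmx0 addr0.
Qed.

Lemma differentiable_mulmxr (R : realType) (V : normedModType R) p q
    (f : V -> 'rV[R]_p) (B : 'M[R]_(p, q)) (t : V) :
  differentiable f t -> differentiable (fun x => f x *m B) t.
Proof.
move=> dft; have cB : continuous (mulmxr B : 'rV[R]_p -> 'rV[R]_q).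
  by move=> x; apply: continuous_mulmxr.
apply: (@differentiable_comp _ _ _ _ f (mulmxr B)) => //.
exact: linear_differentiable.
Qed.

Section projected_immersion.
Variables (R : realType) (n N : nat) (M : oriented_manifold R n).
Variables (F : M -> 'rV[R]_N) (Q : 'M[R]_(n, N)) (c : R).
Hypothesis F_imm : is_immersion F.
Hypothesis Q1 : Q *m Q^T = 1%:M.
Hypothesis c0 : 0 < c.
Hypothesis projF : forall i u, @chart_dom R n M i u -> forall w : 'rV[R]_n,
  c * hs_norm (w *m 'J (local_immersion F i) u) <=
  hs_norm (w *m 'J (local_immersion F i) u *m Q^T).

Definition projection (x : M) : 'rV[R]_n := F x *m Q^T.

Let G := projection.
Let g (i : chart M) : 'rV[R]_n -> 'rV[R]_n := G \o chart_param i.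

Let local_immersion_C1 i : Ck_on 1 (chart_dom i) (local_immersion F i).
Proof. exact: F_imm.1. Qed.

Let is_derive_g i u v : chart_dom i u ->
  is_derive u v (g i) ('D_v (local_immersion F i) u *m Q^T).
Proof.
move=> iu; apply: is_derive_mulmxr; apply: derivableP.
by apply: diff_derivable; exact: (local_immersion_C1 i).1.
Qed.

Let g_C1 i : Ck_on 1 (chart_dom i) (g i).
Proof.
split=> [u iu|v u iu].
  by apply: differentiable_mulmxr; exact: (local_immersion_C1 i).1.
apply: (@near_eq_continuous _ _ (fun w => 'D_v (local_immersion F i) w *m Q^T)).
  have : nbhs u (chart_dom i).
    by apply: open_nbhs_nbhs; split=> //; exact: chart_dom_open.
  apply: filterS => w iw.
  by rewrite (derive_val (is_derive := is_derive_g v iw)).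
by apply: continuous_mulmxr; exact: (local_immersion_C1 i).2.
Qed.

Let jacobian_g i u : chart_dom i u ->
  'J (g i) u = 'J (local_immersion F i) u *m Q^T.
Proof.
move=> iu; apply/row_matrixP => k; rewrite row_mul !jacobian_row.
- by rewrite (derive_val (is_derive := is_derive_g (delta_mx 0 k) iu)).
- exact: (local_immersion_C1 i).1.
- exact: (g_C1 i).1.
Qed.

Let jacobian_g_unit i u : chart_dom i u -> 'J (g i) u \in unitmx.
Proof.
move=> iu; rewrite -row_free_unit; apply: inj_row_free => w.
rewrite jacobian_g // mulmxA => w0; have := projF iu w.
have -> : hs_norm (w *m 'J (local_immersion F i) u *m Q^T) = 0.
  by apply/eqP; rewrite hs_norm_eq0 w0.
rewrite pmulr_rle0 // => wJ0.
have /eqP : hs_norm (w *m 'J (local_immersion F i) u) == 0.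
  by rewrite eq_le wJ0 hs_norm_ge0.
move/eqP; rewrite hs_norm_eq0 => /eqP wJ;
  apply: (row_free_inj (F_imm.2 i u iu)).
by rewrite wJ mul0mx.
Qed.

Let coordP i (x : M) : chart_image i x ->
  chart_dom i (chart_coord i x) /\ chart_param i (chart_coord i x) = x.
Proof. by move=> [u iu <-]; rewrite chart_paramK. Qed.

Let near_chart i (x : M) : chart_image i x -> nbhs x (chart_image i).
Proof.
by move=> ix; apply: open_nbhs_nbhs; split=> //; exact: chart_image_open.
Qed.

Let gE i (x : M) : chart_image i x -> g i (chart_coord i x) = G x.
Proof. by move=> /coordP[_ xE]; rewrite /g /= xE. Qed.

Lemma continuous_projection : continuous projection.
Proof.
move=> x; have [i ix] := chart_cover x; have [iu xE] := coordP ix.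
apply: (@near_eq_continuous _ _ (g i \o chart_coord i)).
  by apply: filterS (near_chart ix) => y iy; exact: gE.
apply: continuous_comp; first exact: chart_coord_continuous.
by apply: differentiable_continuous; exact: (g_C1 i).1.
Qed.

Let local_inverse_at i (x : M) (ix : chart_image i x) :=
  local_inverse (@chart_dom_open _ _ _ i) (coordP ix).1 (g_C1 i)
    (jacobian_g_unit (coordP ix).1).

Lemma projection_loc_inj (x : M) : exists2 W : set M, nbhs x W &
  forall a b, W a -> W b -> projection a = projection b -> a = b.
Proof.
have [i ix] := chart_cover x.
have [r r0 [rU inj _]] := local_inverse_at ix.
exists (chart_image i `&` chart_coord i @^-1` ball (chart_coord i x) r).
  apply: filterI; first exact: near_chart.
  by apply: chart_coord_continuous => //; exact: nbhsx_ballx.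
move=> a b [ia Ba] [ib Bb] Gab.
rewrite -(coordP ia).2 -(coordP ib).2; congr chart_param.
by apply: inj => //; rewrite !gE.
Qed.

Lemma projection_loc_section (x : M) : exists2 r : R, 0 < r &
  exists2 s : 'rV[R]_n -> M, s (projection x) = x &
    section_on projection (ball (projection x) r) s.
Proof.
have [i ix] := chart_cover x.
have [r r0 [rU _ [rho rho0 [s sx sP]]]] := local_inverse_at ix.
rewrite gE // in sx sP.
exists rho => //; exists (chart_param i \o s).
  by rewrite /= sx (coordP ix).2.
move=> y /sP[Bs gs cs]; split=> //.
by apply: continuous_comp cs _; apply: chart_param_continuous; exact: rU.
Qed.

(** * Lengths of curves, the induced distance and completeness *)

Let curve_near_chart (gam : R -> M) i (t : R) : continuous gam ->
  chart_image i (gam t) -> \forall s \near t, chart_image i (gam s).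
Proof. by move=> cgam it; apply: cgam; exact: near_chart. Qed.

Let is_derive_curve (gam : R -> M) i (t : R) : C1_curve gam ->
  chart_image i (gam t) ->
  is_derive t 1 (F \o gam) (derive1 (chart_coord i \o gam) t *m
    'J (local_immersion F i) (chart_coord i (gam t))).
Proof.
move=> [cgam /(_ i)[dgam _]] it; have [iu _] := coordP it.
have du : is_derive t 1 (chart_coord i \o gam) (derive1 (chart_coord i \o gam) t).
  by rewrite derive1E; apply: derivableP; apply: diff_derivable; exact: dgam.
have dF := is_derive_comp_jacobian ((local_immersion_C1 i).1 _ iu) du.
apply: (near_eq_is_derive _ dF).
apply: filterS (curve_near_chart cgam it) => s js.
by rewrite /local_immersion /= (coordP js).2.
Qed.

Let derivable_curve (gam : R -> M) (t : R) : C1_curve gam ->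
  is_derive t 1 (F \o gam) (derive1 (F \o gam) t).
Proof.
move=> C1; have [i it] := chart_cover (gam t); rewrite derive1E.
by apply: derivableP; exact: (@ex_derive _ _ _ _ _ _ _ (is_derive_curve C1 it)).
Qed.

Let continuous_derive_curve (gam : R -> M) : C1_curve gam ->
  continuous (derive1 (F \o gam)).
Proof.
move=> C1 t; have [i it] := chart_cover (gam t).
have [cgam /(_ i)[dgam cdgam]] := C1; have [iu _] := coordP it.
apply: (@near_eq_continuous _ _ (fun s => derive1 (chart_coord i \o gam) s *m
    'J (local_immersion F i) (chart_coord i (gam s)))).
  apply: filterS (curve_near_chart cgam it) => s js.
  by rewrite (derive1E (F \o gam)) (derive_val (is_derive :=
    is_derive_curve C1 js)).
apply: continuous_mulmx.
  have -> : derive1 (chart_coord i \o gam) = 'D_1 (chart_coord i \o gam).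
    by apply/funext => s; rewrite derive1E.
  exact: cdgam.
have cu : {for t, continuous (chart_coord i \o gam)}.
  by apply: differentiable_continuous; exact: dgam.
exact: (continuous_comp cu
  (continuous_jacobian (@chart_dom_open _ _ _ i) (local_immersion_C1 i) iu)).
Qed.

Let continuous_speed (gam : R -> M) : C1_curve gam ->
  continuous (fun t => hs_norm (derive1 (F \o gam) t)).
Proof. by move=> C1 t; apply: cvg_hs_norm; exact: continuous_derive_curve. Qed.

Let projection_coord_le (v : 'rV[R]_N) j : `|(v *m Q^T) 0 j| <= hs_norm v.
Proof.
have Qj : \sum_k Q j k ^+ 2 = 1.
  have /matrixP/(_ j j) := Q1; rewrite !mxE eqxx mulr1n => <-.
  by apply: eq_bigr => k _; rewrite mxE expr2.
rewrite -(@ler_pXn2r _ 2) ?nnegrE ?hs_norm_ge0 // real_normK ?num_real //.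
have := cauchy_schwarz_sum (v 0) (Q j).
rewrite Qj mulr1 sqr_hs_norm big_ord1; apply: le_trans.
by rewrite mxE; under eq_bigr do rewrite mxE.
Qed.

Lemma projection_displacement (gam : R -> M) (s t : R) : C1_curve gam ->
  0 <= s -> s <= t -> t <= 1 ->
  (`|projection (gam t) - projection (gam s)|%:E <= curve_length F gam)%E.
Proof.
move=> C1 s0 st t1.
have coord_le j : (`|(projection (gam t) - projection (gam s)) 0 j|%:E <=
    curve_length F gam)%E.
  pose f (x : R) := (projection (gam x)) 0 j.
  have df (x : R) : is_derive x 1 f ((derive1 (F \o gam) x *m Q^T) 0 j).
    by have /is_derive_mxP := is_derive_mulmxr Q^T (derivable_curve x C1);
      exact.
  have df1 (x : R) : derivable f x 1
    by exact: (@ex_derive _ _ _ _ _ _ _ (df x)).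
  have df2 (x : R) : `|derive1 f x| <= hs_norm (derive1 (F \o gam) x).
    by rewrite derive1E (derive_val (is_derive := df x));
      exact: projection_coord_le.
  have := increment_le_integral df1 (continuous_speed C1) df2 s0 st t1.
  by rewrite /f !mxE.
have L0 : (0 <= curve_length F gam)%E.
  by apply: integral_ge0 => x _; rewrite lee_fin; exact: hs_norm_ge0.
move: coord_le L0; case: (curve_length F gam) => [l||].
- by move=> coord_le; rewrite !lee_fin => l0; apply: rV_norm_le.
- by move=> _ _; rewrite leey.
- by rewrite leeNy_eq.
Qed.

(** This turns limits for the induced distance into limits in the topology of [M]. A short curve
    ending at [x] projects into a small ball, so by unique lifting it runs in the sheet of [s] over
    that ball. *)
Lemma induced_dist_nbhs (x : M) (B : set M) : nbhs x B -> exists2 e : R,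
  0 < e & forall z, (induced_dist F z x < e%:E)%E -> B z.
Proof.
move=> xB; have [r r0 [s sx sP]] := projection_loc_section x.
have [r' r'0 r'P] :
  exists2 r' : R, 0 < r' & ball (projection x) r' `<=` s @^-1` B.
  have : nbhs (projection x) (s @^-1` B).
    by apply: (sP _ _).1; rewrite ?sx //; exact: ballxx.
  by move=> /nbhs_ballP[r' r'0 r'P]; exists r'.
exists (Num.min r r'); first by rewrite lt_min r0.
move=> z /ereal_inf_lt[_ [gam [C1 gam0 gam1 ->]] len].
have close (t : R) : 0 <= t <= 1 ->
  ball (projection x) (Num.min r r') (projection (gam t)).
  move=> /andP[t0 t1]; rewrite -ball_normE /= -gam1 -lte_fin.
  exact: le_lt_trans (projection_displacement C1 t0 t1 (lexx 1)) len.
have cl_ramp t := close _ (ramp_itv t).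
(* The projection is controlled for times in [0, 1], and [ramp] keeps to them. The lifts are
   compared at time 1, where the curve is at [x]. *)
have /(congr1 (fun f => f 0)) : gam \o @ramp R = s \o projection \o (gam \o @ramp R).
  apply: (@unique_lift _ _ _ (@carrier_hausdorff _ _ M) projection
    projection_loc_inj R (gam \o @ramp R) (s \o projection \o (gam \o @ramp R))
    (1 : R)).
  - by apply/connected_intervalP => ? ? _ _ ? _.
  - by move=> t; apply: continuous_comp; [exact: continuous_ramp|exact: C1.1].
  - move=> t; apply: continuous_comp.
      by apply: continuous_comp; [exact: continuous_ramp|exact: C1.1].
    apply: continuous_comp; first exact: continuous_projection.
    apply: (sP _ _).1; apply: le_ball (cl_ramp t).
    by rewrite ge_min lexx.
  - move=> t /=; rewrite (sP _ _).2 //; apply: le_ball (cl_ramp t).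
    by rewrite ge_min lexx.
  - by rewrite /= ramp1 gam1 sx.
rewrite /= ramp0 gam0 => ->; apply: r'P.
by have := cl_ramp 0; rewrite ramp0 gam0; apply: le_ball;
  rewrite ge_min lexx orbT.
Qed.

(** In each chart [is_derive_lift] gives a formula for the derivative that is visibly continuous.
    The speed bound is [projF] applied to the velocity of the lift, whose projection is [dp t]. *)
Lemma lifted_curve (h : R -> M) (p dp : R -> 'rV[R]_n) : continuous h ->
  (forall t, projection (h t) = p t) ->
    (forall t : R, is_derive t 1 p (dp t)) ->
  continuous dp ->
  C1_curve h /\ forall t, c * hs_norm (derive1 (F \o h) t) <= hs_norm (dp t).
Proof.
move=> ch Gh dpP cdp.
have du i t : chart_image i (h t) -> is_derive t 1 (chart_coord i \o h)
    (dp t *m invmx ('J (g i) (chart_coord i (h t)))).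
  move=> it; have [iu _] := coordP it.
  apply: (is_derive_lift (@chart_dom_open _ _ _ i) iu (g_C1 i) (jacobian_g_unit iu)).
  - by [].
  - by apply: continuous_comp; [exact: ch|exact: chart_coord_continuous].
  - apply: (near_eq_is_derive _ (dpP t)).
    by apply: filterS (curve_near_chart ch it) => s js; rewrite /= gE // Gh.
have C1 : C1_curve h.
  split=> // i; split=> [t it|w t it].
    by apply/derivable1_diffP; exact: (@ex_derive _ _ _ _ _ _ _ (du i t it)).
  have [iu _] := coordP it.
  apply: (@near_eq_continuous _ _ (fun s => dp s *m
      invmx ('J (g i) (chart_coord i (h s))) *m w%:M)).
    apply: filterS (curve_near_chart ch it) => s js.
    have ds : differentiable (chart_coord i \o h) s.
      by apply/derivable1_diffP; exact: (@ex_derive _ _ _ _ _ _ _ (du i s js)).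
    rewrite mul_mx_scalar -(derive_val (is_derive := du i s js)) !deriveE //.
    by rewrite -linearZ /GRing.scale /= mulr1.
  apply: continuous_mulmxr; apply: continuous_mulmx; first exact: cdp.
  have cu : {for t, continuous (chart_coord i \o h)}.
    by apply: continuous_comp; [exact: ch|exact: chart_coord_continuous].
  apply: (continuous_invmx (f := fun s => 'J (g i) (chart_coord i (h s)))).
    exact: (continuous_comp cu
      (continuous_jacobian (@chart_dom_open _ _ _ i) (g_C1 i) iu)).
  apply: filterS (curve_near_chart ch it) => s js.
  by apply: jacobian_g_unit; exact: (coordP js).1.
split=> // t; have [i it] := chart_cover (h t); have [iu _] := coordP it.
rewrite derive1E (derive_val (is_derive := is_derive_curve C1 it)).
apply: le_trans (projF iu _) _.
rewrite -mulmxA -jacobian_g // derive1E (derive_val (is_derive := du i t it)).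
by rewrite mulmxKV // jacobian_g_unit.
Qed.

Let ramp_speed (t : R) : R :=
  2 * sin (t * (pi / 2)) * (cos (t * (pi / 2)) * (pi / 2)).

Let ramp_speed_le (t : R) : `|ramp_speed t| <= pi.
Proof.
rewrite /ramp_speed; set x := t * _.
have -> : 2 * sin x * (cos x * (pi / 2)) = (sin x * cos x) * pi by field.
rewrite normrM (ger0_norm (pi_ge0 R)) ler_piMl ?pi_ge0 // normrM.
by rewrite mulr_ile1 // ?sin_max ?cos_max.
Qed.

Let continuous_ramp_speed : continuous ramp_speed.
Proof.
have cx : continuous (fun t : R => t * (pi / 2) : R).
  by move=> t; apply: cvgM; [exact: cvg_id|exact: cvg_cst].
move=> t; apply: cvgM.
  apply: cvgM; first exact: cvg_cst.
  exact: (continuous_comp (@cx t) (@continuous_sin _ _)).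
apply: cvgM; last exact: cvg_cst.
exact: (continuous_comp (@cx t) (@continuous_cos _ _)).
Qed.

(** The factor [pi] bounds the speed of the ramp, and division by [c] accounts for lifting. *)
Lemma induced_dist_lifted_ray (y v : 'rV[R]_n) (tau d : R)
    (f : R -> M) (a b : R) :
  0 < d -> (forall t : R, - d < t < tau -> {for t, continuous f}) ->
  (forall t : R, - d < t < tau -> projection (f t) = y + t *: v) ->
  0 <= a < tau -> 0 <= b < tau ->
  (induced_dist F (f a) (f b) <= (`|b - a| * (pi * hs_norm v / c))%:E)%E.
Proof.
move=> d0 cf Gf /andP[a0 at'] /andP[b0 bt].
(* [q] goes from [a] to [b] on [0, 1] and stays between them at all times, so [f \o q] is a good
   curve on the whole of [R], although [f] is controlled only between [- d] and [tau]. *)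
pose q (t : R) : R := a + (b - a) * ramp t.
have q_itv t : - d < q t < tau.
  have /andP[r0 r1] := ramp_itv t; rewrite /q; move: (ramp t) r0 r1 => s s0 s1.
  have : 0 <= (1 - s) * a + s * b by rewrite addr_ge0 // mulr_ge0 // subr_ge0.
  have [ab|ba] := leP a b.
    have : 0 <= (1 - s) * (b - a) by rewrite mulr_ge0 // subr_ge0.
    by lra.
  have : 0 <= s * (a - b) by rewrite mulr_ge0 // subr_ge0 ltW.
  by lra.
have cq : continuous q.
  move=> t; apply: cvgD; first exact: cvg_cst.
  by apply: cvgM; [exact: cvg_cst|exact: continuous_ramp].
pose h := f \o q.
have ch : continuous h.
  by move=> t; apply: continuous_comp; [exact: cq|exact: cf].
pose p (t : R) := y + q t *: v.
pose dp (t : R) := ((b - a) * ramp_speed t) *: v.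
have Gh t : projection (h t) = p t by rewrite /h /= Gf.
have dpP (t : R) : is_derive t 1 p (dp t).
  apply/is_derive_mxP => i j.
  have -> : (fun s => p s i j) = cst (y i j) + (v i j \*: (cst a + ((b - a) \*: @ramp R))).
    by apply/funext => s; rewrite /p !mxE mulrC.
  have d1 := is_deriveD (is_derive_cst a t (1 : R))
    (is_deriveZ (b - a) (is_derive_ramp t)).
  apply: (is_derive_eq (is_deriveD (is_derive_cst (y i j) t (1 : R))
    (is_deriveZ (v i j) d1))).
  by rewrite !add0r /dp mxE /GRing.scale /= mulrC.
have cdp : continuous dp.
  move=> t; apply: cvgZr_tmp; apply: cvgM; first exact: cvg_cst.
  exact: continuous_ramp_speed.
have [C1 speed] := lifted_curve ch Gh dpP cdp.
set K := _ * _; apply: (@le_trans _ _ (curve_length F h)).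
  apply: ereal_inf_lbound; exists h; split=> //.
    by rewrite /h /q /= ramp0 mulr0 addr0.
  by rewrite /h /q /= ramp1 mulr1 subrKC.
have speedK t : hs_norm (derive1 (F \o h) t) <= K.
  rewrite /K !mulrA ler_pdivlMr // mulrC; apply: le_trans (speed t) _.
  by rewrite hs_normZ normrM -!mulrA ler_wpM2l // ler_wpM2r ?hs_norm_ge0
    ?ramp_speed_le.
have -> : K%:E = (\int[lebesgue_measure]_(t in `[0%R, 1%R]) K%:E)%E.
  rewrite integral_cst //= lebesgue_measure_itv /= lte_fin ltr01.
  by rewrite -EFinD subr0 mule1.
apply: ge0_le_integral => //.
- by move=> t _; rewrite lee_fin; exact: hs_norm_ge0.
- apply/measurable_realfun.measurable_EFinP; apply: measurable_funTS.
  by apply: measurable_realfun.continuous_measurable_fun;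
    exact: continuous_speed.
- by move=> t _; rewrite lee_fin; exact: speedK.
Qed.

(** By the Lipschitz bound, the points at times [t k] tending to [tau] form a Cauchy sequence; its
    limit for the induced distance is a cluster point in the topology. *)
Lemma lifted_ray_cluster (y v : 'rV[R]_n) (tau d : R) (f : R -> M) :
  is_complete F -> 0 < tau -> 0 < d ->
  (forall t : R, - d < t < tau -> {for t, continuous f}) ->
  (forall t : R, - d < t < tau -> projection (f t) = y + t *: v) ->
  exists x, cluster (f @ tau^'-) x.
Proof.
move=> complF tau0 d0 cf Gf.
pose t (k : nat) : R := tau - tau / k.+1%:R.
have frac_gt0 k : 0 < tau / k.+1%:R by rewrite divr_gt0.
have frac_le j k : (j <= k)%N -> tau / k.+1%:R <= tau / j.+1%:R.
  by move=> jk; rewrite ler_wpM2l ?(ltW tau0) // lef_pV2 ?posrE // ler_nat.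
have t_itv k : 0 <= t k < tau.
  have := frac_le 0 k (leq0n k); have := frac_gt0 k; rewrite divr1 /t.
  by move: (tau / k.+1%:R) => z ? ?; lra.
pose K := pi * hs_norm v / c.
have K0 : 0 <= K
  by rewrite /K divr_ge0 ?(ltW c0) // mulr_ge0 ?pi_ge0 ?hs_norm_ge0.
have small (x e : R) : 0 <= x -> 0 < e -> exists k0, forall k, (k0 <= k)%N ->
    tau / k.+1%:R * x < e.
  move=> x0 e0; exists (Num.bound (tau * x / e)) => k k0k.
  have h : tau * x / e < k.+1%:R.
    apply: lt_le_trans (archi_boundP _) _; last by rewrite ler_nat ltnW.
    by rewrite divr_ge0 ?(ltW e0) // mulr_ge0 // ltW.
  rewrite ltr_pdivrMr // in h.
  by rewrite mulrAC ltr_pdivrMr // (mulrC e).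
have [x xlim] : exists x, forall e : R, 0 < e -> exists k0, forall k,
    (k0 <= k)%N -> (induced_dist F (f (t k)) x < e%:E)%E.
  apply: (complF (f \o t)) => e e0; have [k0 k0P] := small K e K0 e0.
  exists k0 => j k jk0 kk0; apply: le_lt_trans.
    exact: (induced_dist_lifted_ray d0 cf Gf (t_itv j) (t_itv k)).
  rewrite lte_fin -/K; apply: le_lt_trans (k0P k0 (leqnn _)).
  rewrite ler_wpM2r // ler_norml /t.
  have := frac_le _ _ jk0; have := frac_le _ _ kk0.
  have := frac_gt0 j; have := frac_gt0 k.
  by move: (tau / j.+1%:R) (tau / k.+1%:R) (tau / k0.+1%:R) => z1 z2 z3 ? ? ? ?; lra.
exists x => A B [e /= e0 eA] xB.
have [e' e'0 e'P] := induced_dist_nbhs xB.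
have [k1 k1P] := xlim _ e'0.
have [k2 k2P] := small 1 e ler01 e0.
pose k := maxn k1 k2; exists (f (t k)); split.
  have /andP[_ ttau] := t_itv k; apply: eA => //.
  rewrite /= /t opprB addrC subrK gtr0_norm //.
  by have := k2P k (leq_maxr _ _); rewrite mulr1.
by apply: e'P; apply: k1P; exact: leq_maxl.
Qed.

End projected_immersion.

Theorem theorem6p6 (R : realType) (n m : nat) (hn : (2 <= n)%N) (hm : (2 <= m)%N)
  (M : oriented_manifold R n) (M_nonempty : [set: M] !=set0)
  (M_connected : connected [set: M])
  (F : M -> 'rV[R]_(n + m)) (F_immersion : is_immersion F)
  (F_complete : is_complete F) (F_minimal : is_minimal F)
  (P0 : set 'M[R]_(n, n + m)) (hP0 : grassmannian R n (n + m) P0)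
  (gauss_ball : range (gauss_map F)
     `<=` geodesic_ball P0 (Num.sqrt 2 / 4 * pi)) :
  has_one_end M.
Proof.
have [x0 _] := M_nonempty.
have radius : 0 <= Num.sqrt 2 / 4 * (pi : R) < pi / 2.
  have s0 : 0 <= Num.sqrt 2 :> R by exact: sqrtr_ge0.
  have s2 : Num.sqrt 2 < 2 :> R.
    by have := @sqr_sqrtr R 2 (ler0n _ _); nra.
  have p0 := pi_gt0 R.
  by rewrite mulr_ge0 ?divr_ge0 ?pi_ge0 //=; nra.
have ball_x x : geodesic_ball P0 (Num.sqrt 2 / 4 * pi) (gauss_map F x).
  by apply: gauss_ball; exists x.
have [c c0 [Q Q1 QP]] := geodesic_ball_projection radius hP0 (ex_intro _ _ (ball_x x0)).
have projF (i : chart M) u : chart_dom i u -> forall w : 'rV[R]_n,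
    c * hs_norm (w *m 'J (local_immersion F i) u) <=
    hs_norm (w *m 'J (local_immersion F i) u *m Q^T).
  move=> iu; apply: QP; have ix : chart_image i (chart_param i u) by exists u.
  by have := ball_x (chart_param i u); rewrite (gauss_map_chart F_immersion ix) chart_paramK.
have cG : continuous (projection F Q) by exact: continuous_projection.
(* Completeness enters here, as the hypothesis that lifted rays cluster at their end time. *)
have [S [cS SK GK]] := global_section (@carrier_hausdorff _ _ M) cG
  (projection_loc_inj F_immersion c0 projF) M_connected
  (projection_loc_section F_immersion c0 projF)
  (fun v tau d f tau0 d0 (_ : f 0 = x0) =>
     lifted_ray_cluster F_immersion Q1 c0 projF F_complete tau0 d0).
exact: (homeo_rV_has_one_end hn cS cG SK GK).
Qed.
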